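(* Let $f:S^2\to(0,\infty)$ be a $C^2$ function on the unit sphere $S^2\subset\mathbb{R}^3$ such that $f(\sigma)=f(-\sigma)$ for all $\sigma\in S^2$. Then $$\sum_{i,j=1}^3\int_{S^2}f\,\big(b_i\cdot\nabla(b_j\cdot\nabla\log f)\big)^2\,d\sigma\ \ge\ \frac{19}{4}\sum_{i=1}^3\int_{S^2}f\,(b_i\cdot\nabla\log f)^2\,d\sigma .$$
   Context: For $\sigma=(\sigma_1,\sigma_2,\sigma_3)\in S^2$, let $b_1(\sigma)=(0,-\sigma_3,\sigma_2)$, $b_2(\sigma)=(\sigma_3,0,-\sigma_1)$, $b_3(\sigma)=(-\sigma_2,\sigma_1,0)$. These are tangent vector fields on $S^2$; for a function $g$ on $S^2$, $b_i\cdot\nabla g$ denotes the derivative of $g$ along $b_i$, with $\nabla=\nabla_\sigma$ the gradient on $S^2$. $d\sigma$ is the surface measure. *)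

(* Defs.v *)
From HB Require Import structures.
From mathcomp Require Import all_boot all_order all_algebra.
From mathcomp Require Import all_classical all_reals all_analysis.

Set Implicit Arguments.
Unset Strict Implicit.
Unset Printing Implicit Defensive.

Import Order.TTheory GRing.Theory Num.Theory.
Import numFieldNormedType.Exports.

Local Open Scope classical_set_scope.
Local Open Scope ring_scope.

Section Sphere.
Variable R : realType.

Definition dot (u v : 'rV[R]_3) : R := \sum_(k < 3) u 0 k * v 0 k.

(* The library norm `|x| on 'rV[R]_3 is the sup norm. *)
Definition enorm (x : 'rV[R]_3) : R := Num.sqrt (dot x x).

Definition S2 : set 'rV[R]_3 := [set x | enorm x = 1].

Definition vec3 (x y z : R) : 'rV[R]_3 := \row_(k < 3) [:: x; y; z]`_k.

Definition basis_vec (k : 'I_3) : 'rV[R]_3 := delta_mx 0 k.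

Definition C2_on (U : set 'rV[R]_3) (F : 'rV[R]_3 -> R) : Prop :=
  [/\ forall x, U x -> differentiable F x,
      forall i x, U x -> differentiable ('D_(basis_vec i) F) x &
      forall i j x, U x -> {for x, continuous ('D_(basis_vec j) ('D_(basis_vec i) F))}].

(* A function on the sphere is represented by a function on 'rV[R]_3 of which
   only the values on S2 matter.  It is C^2 on the submanifold S2 if near each
   point of S2 it is the restriction of a C^2 function of the ambient space. *)
Definition C2_sphere (g : 'rV[R]_3 -> R) : Prop :=
  forall s, S2 s -> exists (U : set 'rV[R]_3) (F : 'rV[R]_3 -> R),
    [/\ open U, U s, C2_on U F & forall x, U x -> S2 x -> F x = g x].

(* x |-> g (x / |x|) *)
Definition radial_ext (g : 'rV[R]_3 -> R) (x : 'rV[R]_3) : R :=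
  g ((enorm x)^-1 *: x).

(* The gradient on S2, as a tangent vector of S2 in R^3: for a differentiable
   extension of g that is constant along rays the ambient gradient has no
   normal component, so it is the tangential gradient of g. *)
Definition sgrad (g : 'rV[R]_3 -> R) (s : 'rV[R]_3) : 'rV[R]_3 :=
  \row_(k < 3) 'D_(basis_vec k) (radial_ext g) s.

(* b 0, b 1, b 2 are b_1, b_2, b_3 *)
Definition b (i : 'I_3) (s : 'rV[R]_3) : 'rV[R]_3 :=
  let s1 := s 0 (inord 0) in
  let s2 := s 0 (inord 1) in
  let s3 := s 0 (inord 2) in
  [:: vec3 0 (- s3) s2; vec3 s3 0 (- s1); vec3 (- s2) s1 0]`_i.

Definition bgrad (i : 'I_3) (g : 'rV[R]_3 -> R) (s : 'rV[R]_3) : R :=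
  dot (b i s) (sgrad g s).

Definition spherical (p : R * R) : 'rV[R]_3 :=
  vec3 (sin p.1 * cos p.2) (sin p.1 * sin p.2) (cos p.1).

(* Integral with respect to surface measure, in the coordinates
   p = (theta, phi); sin theta is the area element
   |d_theta spherical x d_phi spherical|. *)
Definition sphere_int (g : 'rV[R]_3 -> R) : R :=
  Rintegral (lebesgue_measure \x lebesgue_measure)%E
    (`[0, pi] `*` `[0, 2 * pi]) (fun p : R * R => g (spherical p) * sin p.1).

End Sphere.

(* Main.v *)
Require Import Defs.
From mathcomp Require Import all_boot all_order all_algebra.
From mathcomp Require Import all_classical all_reals all_analysis.
From mathcomp Require Import measurable_realfun.
From mathcomp Require Import ring lra.
Import Order.TTheory GRing.Theory Num.Theory.
Import numFieldNormedType.Exports.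
Local Open Scope classical_set_scope.
Local Open Scope ring_scope.

(** Put u = ln f, V_j = b_j . grad u and X_ij = b_i . grad (b_j . grad u).  The
    field b_j generates the rotation about the j-th axis, so for orthogonal unit
    vectors x and e the great circle gamma through x with axis e, turned
    positively about e, satisfies at x
      (u o gamma)' = e . V    and    (u o gamma)'' = e^T X e.
    The function u is even, so u o gamma has period pi, half the length of the
    circle.  This is what makes a one-variable inequality
      int_0^pi exp(v) v''^2 >= 15/4 int_0^pi exp(v) v'^2
    available for v = u o gamma ([half_circle_wirtinger]).  With g = exp(v/2) and
    w = g', the left side is at least 4 int w'^2 and the right side is 15 int w^2.
    The derivative w takes the same value c at two points half a period apart,
    w - c vanishes at the ends of two intervals of length pi/2 that make up the
    period, and the Dirichlet eigenvalue 4 of such an interval exceeds 15/4.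

    Integrating this over all great circles gives an inequality between integrals
    over the orthonormal pairs (x, e), with e outside and x inside.  The two
    integrations may be exchanged ([flag_int_swap]) because the measure involved
    is the rotation-invariant one and is symmetric in x and e.  With x outside,
    the integral over e can be computed: averaged over the unit vectors e
    orthogonal to x,
      (e . V)^2                  has mean 1/2 |V|^2, since V is orthogonal to x;
      (e^T X e)^2 <= |X e|^2     has mean at most 1/2 (|X|^2 - |X x|^2).
    Differentiating x . V = 0 along b_i gives (X x)_i = - b_i . V, hence
    |X x| = |V| ([bgrad_bgrad_radial]).  So
      int f (|X|^2 - |V|^2) >= 15/4 int f |V|^2,
    and 15/4 + 1 = 19/4. *)

(** * Measurability and integrals on the line *)

Lemma floor_approx_cvg (R : realType) (x : R) :
  (Num.floor (x * n.+1%:R))%:~R / n.+1%:R @[n --> \oo] --> x.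
Proof.
apply/cvgrPdist_le => e e0.
near=> n.
have n0 : (0 : R) < n.+1%:R by rewrite ltr0n.
have /andP[h1 h2] := floor_itv (x * n.+1%:R).
have -> : x - (Num.floor (x * n.+1%:R))%:~R / n.+1%:R =
   (x * n.+1%:R - (Num.floor (x * n.+1%:R))%:~R) / n.+1%:R.
  by rewrite mulrBl mulfK // lt0r_neq0.
rewrite normrM normfV [`|n.+1%:R|]gtr0_norm // ger0_norm ?subr_ge0 //.
rewrite ler_pdivrMr //.
have : 1 <= e * n.+1%:R.
  rewrite -ler_pdivrMr // div1r ltW //.
  by near: n; exact: near_infty_natSinv_lt (PosNum e0).
move: h2; rewrite intrD /=; lra.
Unshelve. all: end_near. Qed.

(** [h] is the limit of the functions [h (floor (n x) / n) t], which are step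
    functions in [x]. *)
Lemma measurable_caratheodory (R : realType) (d : measure_display)
    (T : measurableType d) (h : R -> T -> R) :
  (forall t, continuous (h^~ t)) -> (forall x, measurable_fun setT (h x)) ->
  measurable_fun setT (fun p : R * T => h p.1 p.2).
Proof.
move=> ch mh.
pose q (n : nat) (x : R) : R := (Num.floor (x * n.+1%:R))%:~R / n.+1%:R.
apply: (@measurable_fun_cvg _ _ _ setT (fun n p => h (q n p.1) p.2)); last first.
  move=> -[x t] _ /=.
  exact: (cvg_comp _ _ (floor_approx_cvg R x) (ch t x)).
move=> n _ Y mY; rewrite setTI.
pose c (z : int) : R := z%:~R / n.+1%:R.
have -> : (fun p : R * T => h (q n p.1) p.2) @^-1` Y =
  \bigcup_z (`[c z, c (z + 1)[%classic `*` (h (c z) @^-1` Y)).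
  apply/seteqP; split => [[x t]/= Yh|[x t] [z _ [/= xz Yh]]].
    exists (Num.floor (x * n.+1%:R)) => //; split => //=.
    rewrite in_itv /= /c ler_pdivrMr ?ltr0n // ltr_pdivlMr ?ltr0n //.
    exact: floor_itv.
  suff -> : q n x = c z by [].
  congr (_%:~R / _); apply: floor_def.
  move: xz; rewrite in_itv /= /c ler_pdivrMr ?ltr0n //.
  by rewrite ltr_pdivlMr ?ltr0n.
apply: countable_bigcupT_measurable => [|z]; first exact: countableP.
apply: measurableX; first exact: measurable_itv.
by rewrite -[X in measurable X]setTI; exact: mh.
Qed.

Section tonelli_rectangle.
Context (d1 d2 : measure_display) (T1 : measurableType d1)
  (T2 : measurableType d2) (R : realType)
  (m1 : {sigma_finite_measure set T1 -> \bar R})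
  (m2 : {sigma_finite_measure set T2 -> \bar R})
  (A : set T1) (B : set T2) (f : T1 * T2 -> \bar R).
Hypotheses (mA : measurable A) (mB : measurable B)
  (f0 : forall p, A p.1 -> B p.2 -> (0 <= f p)%E)
  (mf : measurable_fun (A `*` B) f).

Let g := f \_ (A `*` B).

Let mg : measurable_fun setT g.
Proof. by apply/(measurable_restrictT _ _).1 => //; exact: measurableX. Qed.

Let g0 p : (0 <= g p)%E.
Proof. by apply: erestrict_ge0 => q []; exact: f0. Qed.

Let fubini_F_patch :
  fubini_F m2 g = (fun x => \int[m2]_(y in B) f (x, y))%E \_ A.
Proof.
apply/funext => x; rewrite /fubini_F [RHS]/patch; case: ifPn => xA.
  rewrite [RHS]integral_mkcond; apply: eq_integral => y _.
  by rewrite /g /patch in_setX /= xA.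
rewrite (_ : (fun y => g (x, y)) = cst 0%E) ?integral0 //.
by apply/funext => y; rewrite /g /patch in_setX /= (negbTE xA).
Qed.

Lemma measurable_tonelli_rect :
  measurable_fun A (fun x => \int[m2]_(y in B) f (x, y))%E.
Proof.
apply/(measurable_restrictT _ mA).2; rewrite -fubini_F_patch.
exact: measurable_fun_fubini_tonelli_F.
Qed.

Lemma tonelli_rect1 : (\int[m1 \x m2]_(p in A `*` B) f p =
  \int[m1]_(x in A) \int[m2]_(y in B) f (x, y))%E.
Proof.
by rewrite integral_mkcond -/g (fubini_tonelli1 g mg g0) [RHS]integral_mkcond
  fubini_F_patch.
Qed.

Lemma tonelli_rect2 : (\int[m1 \x m2]_(p in A `*` B) f p =
  \int[m2]_(y in B) \int[m1]_(x in A) f (x, y))%E.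
Proof.
rewrite integral_mkcond -/g (fubini_tonelli2 g mg g0) [RHS]integral_mkcond.
apply: eq_integral => y _; rewrite /fubini_G [RHS]/patch; case: ifPn => yB.
  rewrite [RHS]integral_mkcond; apply: eq_integral => x _.
  by rewrite /g /patch in_setX /= yB andbT.
rewrite (_ : (fun x => g (x, y)) = cst 0%E) ?integral0 //.
by apply/funext => x; rewrite /g /patch in_setX /= (negbTE yB) andbF.
Qed.

Lemma tonelli_rect : (\int[m1]_(x in A) \int[m2]_(y in B) f (x, y) =
  \int[m2]_(y in B) \int[m1]_(x in A) f (x, y))%E.
Proof. by rewrite -tonelli_rect1 tonelli_rect2. Qed.

End tonelli_rectangle.

Section one_dim.
Context {R : realType}.
Local Notation mu := (@lebesgue_measure R).

Lemma FTC2 (F f : R -> R) (x y : R) : x <= y ->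
  (forall t, x <= t <= y -> is_derive t 1 F (f t)) ->
  {within `[x, y], continuous f} ->
  (\int[mu]_(t in `[x, y]) (f t)%:E = (F y - F x)%:E)%E.
Proof.
rewrite le_eqVlt => /predU1P[<- _ _|xy dF cf].
  by rewrite set_itv1 integral_set1 subrr.
have cF t : x <= t <= y -> {for t, continuous F}.
  by move=> /dF[/derivable1_diffP/differentiable_continuous].
rewrite (@continuous_FTC2 _ _ F) //.
- split.
  + by move=> t /[!in_itv] /= /andP[/ltW xt /ltW ty]; have [] := dF t; rewrite ?xt.
  + by apply/cvg_at_right_filter/cF; rewrite lexx ltW.
  + by apply/cvg_at_left_filter/cF; rewrite lexx ltW.
- move=> t /[!in_itv] /= /andP[/ltW xt /ltW ty].
  by rewrite derive1E; have [] := dF t; rewrite ?xt.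
Qed.

Lemma integral_shift (k : R -> R) (x y s : R) : continuous k -> x <= y ->
  (\int[mu]_(t in `[(x + s)%R, (y + s)%R]) (k t)%:E =
   \int[mu]_(t in `[x, y]) (k (t + s)%R)%:E)%E.
Proof.
move=> ck xy.
have dF t : is_derive t (1 : R) (fun t => t + s) 1.
  exact: is_derive_shift.
have F' : (fun t : R => t + s)^`()%classic = cst 1.
  by apply/funext => t; rewrite derive1E; have [] := dF t.
rewrite (@integration_by_substitution_increasing _ (fun t => t + s) k) //.
- by apply: eq_integral => t _ /=; rewrite /= F' mulr1.
- by move=> ? ? _ _ h; rewrite ltrD2r.
- by rewrite F' => t _; exact: cst_continuous.
- by rewrite F'; exact: is_cvg_cst.
- by rewrite F'; exact: is_cvg_cst.
- have c t : {for t, continuous (fun t => t + s)}.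
    by have [/derivable1_diffP/differentiable_continuous] := dF t.
  split.
  + by move=> t _; have [] := dF t.
  + exact/cvg_at_right_filter/c.
  + exact/cvg_at_left_filter/c.
- by apply: continuous_subspaceT.
Qed.

Lemma integral_itv_cat (k : R -> R) (x y z : R) : continuous k ->
  (forall t, 0 <= k t) -> x <= y -> y <= z ->
  (\int[mu]_(t in `[x, z]) (k t)%:E =
   \int[mu]_(t in `[x, y]) (k t)%:E + \int[mu]_(t in `[y, z]) (k t)%:E)%E.
Proof.
move=> ck k0 xy yz.
have mk D : measurable_fun D (EFin \o k).
  apply/measurable_EFinP/measurable_funTS.
  exact: continuous_measurable_fun.
rewrite -[X in (_ + X)%E]integral_itv_obnd_cbnd //.
rewrite -ge0_integral_setU //=.
- by rewrite -itv_bndbnd_setU // bnd_simp.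
- exact: mk.
- by move=> t _; rewrite lee_fin.
- rewrite disj_set2E; apply/eqP/seteqP; split => // t [] /=.
  rewrite !in_itv /= => /andP[_ h] /andP[h2 _].
  by move: (lt_le_trans h2 h); rewrite ltxx.
Qed.

Lemma integral_periodic_shift (k : R -> R) (T s : R) : continuous k ->
  (forall t, 0 <= k t) -> (forall t, k (t + T) = k t) -> 0 <= s <= T ->
  (\int[mu]_(t in `[0%R, T]) (k (t + s)%R)%:E =
   \int[mu]_(t in `[0%R, T]) (k t)%:E)%E.
Proof.
move=> ck k0 kT /andP[s0 sT].
have T0 := le_trans s0 sT.
rewrite -integral_shift // add0r (@integral_itv_cat _ s T) //; last first.
  by rewrite lerDl.
rewrite (_ : `[T, T + s]%classic = `[0 + T, s + T]%classic :> set R); last first.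
  by rewrite add0r addrC.
rewrite integral_shift //.
rewrite [X in (_ + X)%E](_ : _ = \int[mu]_(t in `[0%R, s]) (k t)%:E)%E; last first.
  by apply: eq_integral => t _; rewrite kT.
by rewrite addeC -integral_itv_cat.
Qed.

End one_dim.

(** * The substitution q = r cos t and its singular form *)

Section cosine_substitution.
Context {R : realType}.
Local Notation mu := (@lebesgue_measure R).

Lemma cos_substitution (g : R -> R) (c x y : R) : continuous g -> 0 < c ->
  0 <= x -> x <= y -> y <= pi ->
  (\int[mu]_(q in `[(c * cos y)%R, (c * cos x)%R]) (g q)%:E =
   \int[mu]_(t in `[x, y]) (g (c * cos t) * (c * sin t))%:E)%E.
Proof.
move=> cg c0 x0 xy ypi.
have dF t : is_derive t (1 : R) (fun t => c * cos t) (- (c * sin t)).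
  have -> : (fun t => c * cos t) = c \*: cos by [].
  by apply: is_derive_eq; rewrite /GRing.scale /= mulrN.
have F' : (fun t : R => c * cos t)^`()%classic = (fun t => - (c * sin t)).
  by apply/funext => t; rewrite derive1E; have [] := dF t.
have cF t : {for t, continuous (fun t => c * cos t)}.
  by have [/derivable1_diffP/differentiable_continuous] := dF t.
have cF' : continuous (fun t : R => - (c * sin t)).
  move=> t; apply: (@continuousN _ _ _ (fun t => c * sin t)).
  by apply: continuousM; [exact: cst_continuous|exact: continuous_sin].
rewrite (@integration_by_substitution_decreasing _ (fun t => c * cos t) g) //.
- by apply: eq_integral => t _ /=; rewrite /= F' opprK.
- move=> s t; rewrite !in_itv /= => /andP[h1 h2] /andP[h3 h4] st.
  rewrite ltr_pM2l // ltr_cos // in_itv /=.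
    by rewrite (le_trans x0 h3) (le_trans h4).
  by rewrite (le_trans x0 h1) (le_trans h2).
- by rewrite F' => t _; exact: cF'.
- by rewrite F'; apply/cvg_ex; eexists; apply/cvg_at_right_filter/cF'.
- by rewrite F'; apply/cvg_ex; eexists; apply/cvg_at_left_filter/cF'.
- split.
  + by move=> t _; have [] := dF t.
  + exact/cvg_at_right_filter/cF.
  + exact/cvg_at_left_filter/cF.
- by apply: continuous_subspaceT.
Qed.

Lemma lt_acos_cos (r b : R) : 0 <= r <= 1 -> 0 <= b <= pi ->
  (cos b ^+ 2 < r ^+ 2) = (acos r < b < acos (- r)).
Proof.
move=> /andP[r0 r1] b0.
have hr : -1 <= r <= 1 by rewrite r1 andbT (le_trans _ r0) // lerN10.
have hnr : -1 <= - r <= 1 by rewrite lerN2 r1 lerNl (le_trans _ r0) // lerN10.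
have mem (z : R) : -1 <= z <= 1 -> acos z \in `[0, pi].
  by move=> hz; rewrite in_itv /= acos_ge0 // acos_lepi.
rewrite -[X in _ = (X && _)]ltr_cos ?mem //.
rewrite -[X in _ = (_ && X)]ltr_cos ?mem //.
rewrite !acosK ?in_itv // andbC -ltr_norml -[cos b ^+ 2]real_normK ?num_real //.
by rewrite ltr_pXn2r // nnegrE.
Qed.

Lemma cos_substitution_regular (g : R -> R) (r : R) : continuous g ->
  0 < r <= 1 ->
  (\int[mu]_(t in `]0%R, pi[) (g (r * cos t) * (r * sin t))%:E =
   \int[mu]_(b in `]0%R, pi[)
     (if (cos b ^+ 2 < r ^+ 2)%R then g (cos b) * sin b else 0)%:E)%E.
Proof.
move=> cg /andP[r0 r1].
have r11 : -1 <= r <= 1 by rewrite r1 andbT (le_trans _ (ltW r0)) // lerN10.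
have nr11 : -1 <= - r <= 1 by rewrite lerN2 r1 lerNl (le_trans _ (ltW r0)) // lerN10.
have mc D (h : R -> R) : continuous h -> measurable_fun D (EFin \o h).
  move=> ch; apply/measurable_EFinP/measurable_funTS.
  exact: continuous_measurable_fun.
have ccos c : continuous (fun t : R => c * cos t).
  by move=> t; apply: cvgM; [exact: cvg_cst|exact: continuous_cos].
have csin c : continuous (fun t : R => c * sin t).
  by move=> t; apply: cvgM; [exact: cvg_cst|exact: continuous_sin].
have cc c : continuous (fun t => g (c * cos t) * (c * sin t)).
  move=> t; apply: cvgM; last exact: csin.
  exact: (continuous_comp (ccos c t) (cg _)).
rewrite -(@integral_itv_bndoo _ _ _ _ true false); last exact: mc.
rewrite -cos_substitution //; last exact: pi_ge0.
have mem (z : R) : -1 <= z <= 1 -> acos z \in `[0, pi].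
  by move=> hz; rewrite in_itv /= acos_ge0 // acos_lepi.
have acosle : acos r <= acos (- r).
  rewrite leNgt; apply/negP; rewrite -ltr_cos ?mem // !acosK ?in_itv //.
  by move: r0; clear; lra.
have -> : (\int[mu]_(q in `[(r * cos pi)%R, (r * cos 0)%R]) (g q)%:E =
    \int[mu]_(q in `[(1 * cos (acos (- r)))%R, (1 * cos (acos r))%R]) (g q)%:E)%E.
  by rewrite cospi cos0 !acosK ?in_itv // !mul1r mulr1 mulrN1.
rewrite cos_substitution ?acos_ge0 ?acos_lepi //.
rewrite (@integral_itv_bndoo _ _ _ _ true false); last exact: mc.
have -> : `]acos r, acos (- r)[%classic =
    `]0, pi[ `&` [set b : R | cos b ^+ 2 < r ^+ 2].
  apply/seteqP; split => b /=; rewrite !in_itv /=.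
    move=> /andP[h1 h2]; have h3 : 0 < b by rewrite (le_lt_trans _ h1) ?acos_ge0.
    have h4 : b < pi by rewrite (lt_le_trans h2) ?acos_lepi.
    rewrite h3 h4; split => //; rewrite lt_acos_cos ?h1 ?(ltW r0) //.
    by rewrite (ltW h3) (ltW h4).
  by move=> [/andP[/ltW h1 /ltW h2]]; rewrite lt_acos_cos ?h1 ?h2 ?(ltW r0).
rewrite integral_mkcondr; apply: eq_integral => b _.
rewrite /patch; case: (boolP (cos b ^+ 2 < r ^+ 2)) => h.
  by rewrite mem_set // !mul1r.
by rewrite memNset //; exact/negP.
Qed.

Lemma regularized_weight_cvg (u s : R) : 0 < s ->
  u / (s + n.+1%:R^-1) @[n --> \oo] --> u / s.
Proof.
move=> s0; apply: cvgM; first exact: cvg_cst.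
apply: cvgV; first by rewrite gt_eqF.
rewrite -[X in _ --> X]addr0; apply: cvgD; first exact: cvg_cst.
exact: cvg_harmonic.
Qed.

Lemma regularized_weight_nd (u s : R) : 0 <= u -> 0 <= s ->
  {homo (fun n : nat => u / (s + n.+1%:R^-1)) : m n / (m <= n)%N >-> m <= n}.
Proof.
move=> u0 s0 m n mn; apply: ler_wpM2l => //.
rewrite lef_pV2 ?posrE ?addr_ge0 ?ltr_wpDl // lerD2l lef_pV2 ?posrE //.
by rewrite ler_nat.
Qed.

(** This is the regular substitution applied to [g q / sqrt (r^2 - q^2)], the
    factor [r sin t] being [sqrt (r^2 - q^2)].  Since this weight is singular at
    the ends, it is first replaced by [1 / (sqrt (r^2 - q^2) + 1 / (n + 1))], and
    monotone convergence is used on both sides. *)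
Lemma cos_substitution_singular (g : R -> R) (r : R) : continuous g ->
  (forall q, 0 <= g q) -> 0 < r <= 1 ->
  (\int[mu]_(t in `]0%R, pi[) (g (r * cos t))%:E =
   \int[mu]_(b in `]0%R, pi[)
     (if (cos b ^+ 2 < r ^+ 2)%R then
        g (cos b) * sin b / Num.sqrt (r ^+ 2 - cos b ^+ 2) else 0)%:E)%E.
Proof.
move=> cg g0 r01; have /andP[r0 r1] := r01.
pose w q : R := Num.sqrt (r ^+ 2 - q ^+ 2).
have w0 q : 0 <= w q by exact: sqrtr_ge0.
have cw : continuous w.
  move=> q; apply: (@continuous_comp _ _ _ (fun q : R => r ^+ 2 - q ^+ 2)).
    apply: cvgB; first exact: cvg_cst.
    exact: exprn_continuous.
  exact: sqrt_continuous.
have dn0 n q : 0 < w q + n.+1%:R^-1 by rewrite ltr_wpDl.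
pose gn n q := g q / (w q + n.+1%:R^-1).
have cgn n : continuous (gn n).
  move=> q; apply: cvgM; first exact: cg.
  apply: cvgV; first by rewrite gt_eqF.
  by apply: cvgD; [exact: cw|exact: cvg_cst].
have wE t : 0 < t < pi -> w (r * cos t) = r * sin t.
  move=> /andP[t0 tpi]; rewrite /w.
  have -> : r ^+ 2 - (r * cos t) ^+ 2 = (r * sin t) ^+ 2.
    by rewrite !exprMn sin2cos2; ring.
  rewrite sqrtr_sqr ger0_norm // mulr_ge0 ?ltW //.
  by rewrite sin_gt0_pi // t0.
have ccos : continuous (fun t : R => r * cos t).
  by move=> t; apply: cvgM; [exact: cvg_cst|exact: continuous_cos].
have csin : continuous (fun t : R => r * sin t).
  by move=> t; apply: cvgM; [exact: cvg_cst|exact: continuous_sin].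
have mset : measurable [set b : R | cos b ^+ 2 < r ^+ 2].
  rewrite -[X in measurable X]setTI.
  apply: open_measurable; rewrite setTI.
  apply: (@open_comp _ _ (fun b : R => cos b ^+ 2) [set x | x < r ^+ 2]).
    move=> b _; apply: (@continuous_comp _ _ _ cos (fun x : R => x ^+ 2)).
      exact: continuous_cos.
    exact: exprn_continuous.
  exact: open_lt.
have mc D (h : R -> R) : continuous h -> measurable_fun D (EFin \o h).
  move=> ch; apply/measurable_EFinP/measurable_funTS.
  exact: continuous_measurable_fun.
have cvgL : (\int[mu]_(t in `]0%R, pi[) (gn n (r * cos t) * (r * sin t))%:E
    @[n --> \oo] --> \int[mu]_(t in `]0%R, pi[) (g (r * cos t))%:E)%E.
  pose G n t := (g (r * cos t) * (r * sin t) / (r * sin t + n.+1%:R^-1))%:E.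
  rewrite [X in X @ _](_ : _ = fun n => \int[mu]_(t in `]0%R, pi[) G n t)%E; last first.
    apply/funext => n; apply: eq_integral => t; rewrite inE /= in_itv /= => tI.
    by rewrite /gn /G wE // mulrAC.
  have rs0 t : 0 < t < pi -> 0 < r * sin t by move=> /sin_gt0_pi; exact: mulr_gt0.
  rewrite [X in _ --> X](_ : _ =
      \int[mu]_(t in `]0%R, pi[) (limn (G^~ t)))%E; last first.
    apply: eq_integral => t; rewrite inE /= in_itv /= => /rs0 tI.
    apply/esym/cvg_lim => //; apply: cvg_EFin; first by near=> n.
    have := regularized_weight_cvg (g (r * cos t) * (r * sin t)) _ tI.
    by rewrite mulfK ?gt_eqF.
  apply: cvg_monotone_convergence => //.
  - move=> n; apply: (@eq_measurable_fun _ _ _ _ _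
      (EFin \o (fun t => gn n (r * cos t) * (r * sin t)))).
      move=> t; rewrite inE /= in_itv /= => tI.
      by rewrite /gn /G wE // mulrAC.
    apply: mc => t; apply: cvgM; last exact: csin.
    exact: (continuous_comp (ccos t) (cgn n _)).
  - move=> n t; rewrite /= in_itv /= => /rs0/ltW tI.
    rewrite lee_fin; apply: divr_ge0; first exact: mulr_ge0.
    by apply: addr_ge0.
  - move=> t; rewrite /= in_itv /= => /rs0/ltW tI m n mn.
    by rewrite lee_fin; apply: regularized_weight_nd => //; rewrite mulr_ge0.
have cvgR : (\int[mu]_(b in `]0%R, pi[)
      (if (cos b ^+ 2 < r ^+ 2)%R then gn n (cos b) * sin b else 0)%:E
    @[n --> \oo] --> \int[mu]_(b in `]0%R, pi[)
     (if (cos b ^+ 2 < r ^+ 2)%R then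
        g (cos b) * sin b / Num.sqrt (r ^+ 2 - cos b ^+ 2) else 0)%:E)%E.
  pose G n b := (if (cos b ^+ 2 < r ^+ 2)%R then gn n (cos b) * sin b else 0)%:E.
  rewrite [X in _ --> X](_ : _ =
      \int[mu]_(t in `]0%R, pi[) (limn (G^~ t)))%E; last first.
    apply: eq_integral => t; rewrite inE /= in_itv /= => tI.
    apply/esym/cvg_lim => //; apply: cvg_EFin; first by near=> n.
    rewrite /G /=; case: ifPn => [h|_]; last exact: cvg_cst.
    rewrite [X in X @ _](_ : _ =
        fun n : nat => g (cos t) * sin t / (w (cos t) + n.+1%:R^-1)).
      by apply: regularized_weight_cvg; rewrite /w sqrtr_gt0 subr_gt0.
    by apply/funext => n; rewrite /gn mulrAC.
  apply: cvg_monotone_convergence => //.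
  - move=> n; apply/measurable_EFinP/measurable_funTS.
    apply: (measurable_fun_ifT (f := fun b : R => cos b ^+ 2 < r ^+ 2)) => //.
      apply: (measurable_fun_bool true); rewrite setTI.
      rewrite [X in measurable X](_ : _ = [set b : R | cos b ^+ 2 < r ^+ 2]) //.
    apply: continuous_measurable_fun => t; apply: cvgM; last exact: continuous_sin.
    by apply: (@continuous_comp _ _ _ cos (gn n)); [exact: continuous_cos|exact: cgn].
  - move=> n t; rewrite /= in_itv /= => /sin_gt0_pi/ltW tI; rewrite lee_fin.
    by case: ifP => // _; rewrite mulr_ge0 // divr_ge0 // ltW.
  - move=> t; rewrite /= in_itv /= => /sin_gt0_pi/ltW tI m n mn; rewrite lee_fin.
    case: ifP => // _; rewrite ler_wpM2r // /gn.
    by apply: regularized_weight_nd.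
apply/esym; rewrite -(cvg_lim _ cvgL) // -(cvg_lim _ cvgR) //.
by congr (limn _); apply/funext => n; rewrite cos_substitution_regular.
Unshelve. all: end_near. Qed.
End cosine_substitution.

(** * Coordinates on the orthonormal pairs *)

Section vec3_facts.
Context {R : realType}.

Lemma vec3E (x y z : R) :
  vec3 x y z = x *: basis_vec R 0 + y *: basis_vec R 1 + z *: basis_vec R (inord 2).
Proof.
apply/rowP => k; rewrite !mxE !eqxx /=.
case: k => [[|[|[|//]]]] hk /=; rewrite -!val_eqE /= ?inordK //=.
- by rewrite !mulr0 !mulr1 !addr0.
- by rewrite !mulr0 !mulr1 !addr0 add0r.
- by rewrite !mulr0 !mulr1 !add0r.
Qed.

Lemma vec3_cvg (T : Type) (F : set_system T) (FF : Filter F) (x y z : T -> R)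
    (a b c : R) :
  x t @[t --> F] --> a -> y t @[t --> F] --> b -> z t @[t --> F] --> c ->
  vec3 (x t) (y t) (z t) @[t --> F] --> vec3 a b c.
Proof.
move=> xa yb zc; rewrite vec3E.
rewrite [X in X @ _](_ : _ = fun t => x t *: basis_vec R 0 +
   y t *: basis_vec R 1 + z t *: basis_vec R (inord 2)); last first.
  by apply/funext => t; rewrite vec3E.
by apply: cvgD; [apply: cvgD|]; apply: cvgZ => //; exact: cvg_cst.
Qed.

Lemma dotE (u v : 'rV[R]_3) : dot u v =
  u 0 (inord 0) * v 0 (inord 0) + u 0 (inord 1) * v 0 (inord 1) +
  u 0 (inord 2) * v 0 (inord 2).
Proof.
rewrite /dot !big_ord_recr big_ord0 /= add0r.
by congr (u 0 _ * v 0 _ + u 0 _ * v 0 _ + u 0 _ * v 0 _);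
  apply/val_inj; rewrite /= inordK.
Qed.

Lemma vec3_0 (x y z : R) : vec3 x y z 0 (inord 0) = x.
Proof. by rewrite mxE inordK. Qed.
Lemma vec3_1 (x y z : R) : vec3 x y z 0 (inord 1) = y.
Proof. by rewrite mxE inordK. Qed.
Lemma vec3_2 (x y z : R) : vec3 x y z 0 (inord 2) = z.
Proof. by rewrite mxE inordK. Qed.
Definition vec3_coord := (vec3_0, vec3_1, vec3_2).

Lemma vec3_neq0 (x y z : R) : x ^+ 2 + y ^+ 2 + z ^+ 2 != 0 -> vec3 x y z != 0.
Proof.
apply: contra_neq => v0.
have := vec3_0 x y z; have := vec3_1 x y z; have := vec3_2 x y z.
by rewrite v0 !mxE => <- <- <-; rewrite expr0n !addr0.
Qed.
End vec3_facts.

Section frames.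
Context {R : realType}.
Implicit Types (th ph al be q sg : R).

Lemma sphericalE th ph : spherical (th, ph) =
  vec3 (sin th * cos ph) (sin th * sin ph) (cos th).
Proof. by []. Qed.

(** Minus [cos al] times the southward plus [sg * sin al] times the eastward unit
    tangent vector at [spherical (th, ph)].  With [al] in ]0, pi[ this covers only
    the half circle on the side [sg] of the meridian: there the third coordinate
    determines the vector, which [conormal_at] exploits, and half a circle is
    enough for functions that are even in the vector. *)
Definition conormal sg th ph al : 'rV[R]_3 :=
  vec3 (- (cos al * cos th * cos ph) - sg * sin al * sin ph)
       (- (cos al * cos th * sin ph) + sg * sin al * cos ph)
       (cos al * sin th).

(** The same half circle, parametrised by the third coordinate
    [q = sin th * cos al]; see [conormal_atE]. *)
Definition conormal_at sg th ph q : 'rV[R]_3 :=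
  let s := Num.sqrt (sin th ^+ 2 - q ^+ 2) in
  vec3 (- (q * cos th * cos ph + sg * s * sin ph) / sin th)
       (- (q * cos th * sin ph - sg * s * cos ph) / sin th) q.

Lemma conormal_atE sg th ph al : 0 < th < pi -> 0 < al < pi ->
  conormal_at sg th ph (sin th * cos al) = conormal sg th ph al.
Proof.
move=> /sin_gt0_pi th0 /sin_gt0_pi al0.
have sE : Num.sqrt (sin th ^+ 2 - (sin th * cos al) ^+ 2) = sin th * sin al.
  have -> : sin th ^+ 2 - (sin th * cos al) ^+ 2 = (sin th * sin al) ^+ 2.
    by rewrite !exprMn (sin2cos2 al); ring.
  by rewrite sqrtr_sqr ger0_norm // mulr_ge0 // ltW.
rewrite /conormal_at sE /conormal; congr vec3; last by rewrite mulrC.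
- by field; rewrite gt_eqF.
- by field; rewrite gt_eqF.
Qed.

Lemma spherical_neq0 th ph : spherical (th, ph) != 0.
Proof.
rewrite sphericalE; apply: vec3_neq0.
have -> : (sin th * cos ph) ^+ 2 + (sin th * sin ph) ^+ 2 + cos th ^+ 2 = 1.
  by rewrite !exprMn -mulrDr cos2Dsin2 mulr1 addrC cos2Dsin2.
exact: oner_neq0.
Qed.

Lemma conormal_at_neq0 sg th ph q : sg ^+ 2 = 1 -> 0 < th < pi ->
  conormal_at sg th ph q != 0.
Proof.
move=> sg2 /sin_gt0_pi th0; rewrite /conormal_at.
set s := Num.sqrt _.
have [q0|q0] := eqVneq q 0; last first.
  apply: vec3_neq0; rewrite gt_eqF // ltr_wpDl // ?addr_ge0 ?sqr_ge0 //.
  by rewrite exprn_even_gt0.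
have sE : s = sin th by rewrite /s q0 expr0n subr0 sqrtr_sqr gtr0_norm.
apply: vec3_neq0; rewrite sE q0.
have -> : (- (0 * cos th * cos ph + sg * sin th * sin ph) / sin th) ^+ 2 +
   (- (0 * cos th * sin ph - sg * sin th * cos ph) / sin th) ^+ 2 + 0 ^+ 2 =
   sg ^+ 2 * (cos ph ^+ 2 + sin ph ^+ 2) by field; rewrite gt_eqF.
by rewrite cos2Dsin2 sg2 mulr1 oner_neq0.
Qed.

(** The pairs (x, e) and (e, x) seen from the two poles: with
    cos th = x_3 and cos be = e_3, turning by psi about the third axis takes
    one description to the other.  The sign changes because x lies west of the
    meridian of e when e lies east of the meridian of x. *)
Lemma conormal_rotation sg th be : sg ^+ 2 = 1 -> 0 < th < pi -> 0 < be < pi ->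
  cos be ^+ 2 < sin th ^+ 2 ->
  exists2 psi, 0 <= psi <= 2 * pi & forall ph,
    spherical (be, ph + psi) = conormal_at sg th ph (cos be) /\
    conormal_at (- sg) be (ph + psi) (cos th) = spherical (th, ph).
Proof.
move=> sg2 /sin_gt0_pi th0 /sin_gt0_pi be0 hbt.
pose s := Num.sqrt (sin th ^+ 2 - cos be ^+ 2).
have s2 : s ^+ 2 = sin th ^+ 2 - cos be ^+ 2 by rewrite sqr_sqrtr // subr_ge0 ltW.
have sE : Num.sqrt (sin be ^+ 2 - cos th ^+ 2) = s.
  by congr Num.sqrt; rewrite !sin2cos2; ring.
pose C := - (cos th * cos be) / (sin th * sin be).
pose S := sg * s / (sin th * sin be).
have CS : C ^+ 2 + S ^+ 2 = 1.
  have -> : C ^+ 2 + S ^+ 2 = (cos th ^+ 2 * cos be ^+ 2 + sg ^+ 2 * s ^+ 2) /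
     (sin th ^+ 2 * sin be ^+ 2) by rewrite /C /S; field; rewrite !gt_eqF.
  rewrite sg2 s2 mul1r (cos2sin2 th) (cos2sin2 be).
  by field; rewrite !gt_eqF.
have [psi psi0 [cpsi spsi]] : exists2 psi, 0 <= psi <= 2 * pi &
    cos psi = C /\ sin psi = S.
  have C1 : -1 <= C <= 1.
    rewrite -ler_norml -(@expr_le1 _ 2) // real_normK ?num_real //.
    by rewrite -CS lerDl sqr_ge0.
  have S2 : Num.sqrt (1 - C ^+ 2) = `|S| by rewrite -CS addrC addKr sqrtr_sqr.
  have [S0|S0] := leP 0 S.
    exists (acos C).
      rewrite acos_ge0 // (le_trans (acos_lepi C1)) //.
      by have := pi_ge0 R; lra.
    by rewrite acosK ?in_itv // sin_acos // S2 ger0_norm.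
  exists (2 * pi - acos C).
    have := acos_ge0 C1; have := acos_lepi C1; have := pi_ge0 R; lra.
  have -> : 2 * pi = (pi *+ 2 : R) by rewrite mulr2n; ring.
  rewrite cosB sinB cos2pi sin2pi acosK ?in_itv // sin_acos // S2 ltr0_norm //.
  by split; ring.
exists psi => // ph.
have eC : cos th * cos be = - (sin th * sin be * C).
  by rewrite /C; field; rewrite !gt_eqF.
have eS : sg * s = sin th * sin be * S by rewrite /S; field; rewrite !gt_eqF.
have cC := cosD ph psi; have sC := sinD ph psi.
rewrite cpsi spsi in cC sC.
rewrite !sphericalE /conormal_at sE cC sC -/s.
split; congr vec3.
- rewrite [cos be * _]mulrC eC eS; by field; rewrite gt_eqF.
- rewrite [cos be * _]mulrC eC eS; by field; rewrite gt_eqF.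
- rewrite [- sg * s]mulNr eC eS.
  have -> : sin th * cos ph = sin th * cos ph * (C ^+ 2 + S ^+ 2) by rewrite CS mulr1.
  by field; rewrite gt_eqF.
- rewrite [- sg * s]mulNr eC eS.
  have -> : sin th * sin ph = sin th * sin ph * (C ^+ 2 + S ^+ 2) by rewrite CS mulr1.
  by field; rewrite gt_eqF.
Qed.

End frames.

Lemma continuous_comp2 (R : realType) (T : topologicalType)
    (K : 'rV[R]_3 -> 'rV[R]_3 -> R) (c1 c2 : T -> 'rV[R]_3) (t : T) :
  {for (c1 t, c2 t), continuous (fun p => K p.1 p.2)} ->
  {for t, continuous c1} -> {for t, continuous c2} ->
  {for t, continuous (fun t => K (c1 t) (c2 t))}.
Proof.
by move=> cK cc1 cc2; exact: (cvg_comp2 cc1 cc2 cK).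
Qed.

Section curves.
Context {R : realType}.
Implicit Types (th ph al be q sg : R).

Let cM (f g : R -> R) : continuous f -> continuous g ->
  continuous (fun t => f t * g t).
Proof. by move=> cf cg t; apply: cvgM; [exact: cf|exact: cg]. Qed.
Let cD (f g : R -> R) : continuous f -> continuous g ->
  continuous (fun t => f t + g t).
Proof. by move=> cf cg t; apply: cvgD; [exact: cf|exact: cg]. Qed.
Let cN (f : R -> R) : continuous f -> continuous (fun t => - f t).
Proof. by move=> cf t; apply: cvgN; exact: cf. Qed.
Let cC (c : R) : continuous (fun _ : R => c).
Proof. by move=> t; exact: cvg_cst. Qed.
Let csin : continuous (@sin R) := @continuous_sin R.
Let ccos : continuous (@cos R) := @continuous_cos R.
Let cv (x y z : R -> R) : continuous x -> continuous y -> continuous z ->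
  continuous (fun t => vec3 (x t) (y t) (z t)).
Proof.
by move=> cx cy cz t; apply: vec3_cvg; [exact: cx|exact: cy|exact: cz].
Qed.

Let cid : continuous (fun t : R => t).
Proof. by move=> t. Qed.
Let csqrt (f : R -> R) : continuous f -> continuous (fun t => Num.sqrt (f t)).
Proof.
move=> cf t; apply: (@continuous_comp _ _ _ f); first exact: cf.
exact: sqrt_continuous.
Qed.

Lemma continuous_spherical_ph th : continuous (fun ph => spherical (th, ph)).
Proof.
have H := (cv _ _ _ (cM _ _ (cC (sin th)) ccos) (cM _ _ (cC (sin th)) csin) (cC (cos th))).
exact: H.
Qed.

Lemma continuous_spherical_th ph : continuous (fun th => spherical (th, ph)).
Proof.
have H := (cv _ _ _ (cM _ _ csin (cC (cos ph))) (cM _ _ csin (cC (sin ph))) ccos).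
exact: H.
Qed.

Lemma continuous_conormal_al sg th ph : continuous (conormal sg th ph).
Proof.
have c1 := cN _ (cM _ _ (cM _ _ ccos (cC (cos th))) (cC (cos ph))).
have c2 := cN _ (cM _ _ (cM _ _ (cC sg) csin) (cC (sin ph))).
have c3 := cN _ (cM _ _ (cM _ _ ccos (cC (cos th))) (cC (sin ph))).
have c4 := cM _ _ (cM _ _ (cC sg) csin) (cC (cos ph)).
have H := (cv _ _ _ (cD _ _ c1 c2) (cD _ _ c3 c4) (cM _ _ ccos (cC (sin th)))).
exact: H.
Qed.

Lemma continuous_conormal_at_ph sg th q :
  continuous (fun ph => conormal_at sg th ph q).
Proof.
rewrite /conormal_at /=; set s := Num.sqrt _.
have c1 := cN _ (cD _ _ (cM _ _ (cC (q * cos th)) ccos) (cM _ _ (cC (sg * s)) csin)).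
have c2 := cN _ (cD _ _ (cM _ _ (cC (q * cos th)) csin)
  (cN _ (cM _ _ (cC (sg * s)) ccos))).
have H := (cv _ _ _ (cM _ _ c1 (cC (sin th)^-1)) (cM _ _ c2 (cC (sin th)^-1)) (cC q)).
exact: H.
Qed.

Lemma continuous_conormal_at_q sg th ph : continuous (conormal_at sg th ph).
Proof.
have cs : continuous (fun q => Num.sqrt (sin th ^+ 2 - q ^+ 2)).
  have H := csqrt _ (cD _ _ (cC (sin th ^+ 2)) (cN _ (cM _ _ cid cid))).
  exact: H.
have q1 c := cM _ _ (cM _ _ cid (cC (cos th))) (cC c).
have s1 c := cM _ _ (cM _ _ (cC sg) cs) (cC c).
have c1 := cN _ (cD _ _ (q1 (cos ph)) (s1 (sin ph))).
have c2 := cN _ (cD _ _ (q1 (sin ph)) (cN _ (s1 (cos ph)))).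
have H := (cv _ _ _ (cM _ _ c1 (cC (sin th)^-1)) (cM _ _ c2 (cC (sin th)^-1)) cid).
exact: H.
Qed.

Lemma continuous_conormal_at_th sg th ph q : 0 < th < pi ->
  {for th, continuous (fun th => conormal_at sg th ph q)}.
Proof.
move=> /sin_gt0_pi th0.
have cV : (sin t)^-1 @[t --> th] --> (sin th)^-1.
  by apply: cvgV; [rewrite gt_eqF|exact: csin].
have cs : continuous (fun th => Num.sqrt (sin th ^+ 2 - q ^+ 2)).
  have H := csqrt _ (cD _ _ (cM _ _ csin csin) (cC (- q ^+ 2))).
  exact: H.
have q1 c := cM _ _ (cM _ _ (cC q) ccos) (cC c).
have s1 c := cM _ _ (cM _ _ (cC sg) cs) (cC c).
have c1 := cN _ (cD _ _ (q1 (cos ph)) (s1 (sin ph))).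
have c2 := cN _ (cD _ _ (q1 (sin ph)) (cN _ (s1 (cos ph)))).
apply: vec3_cvg; [|by apply: cvgM cV; exact: c2|exact: cvg_cst].
by apply: cvgM cV; exact: c1.
Qed.

End curves.

(** * The symmetry of the invariant measure on orthonormal pairs *)

Lemma measurable_inv (R : realType) : measurable_fun setT (@GRing.inv R).
Proof.
pose D := ~` [set (0 : R)].
have -> : @GRing.inv R = @GRing.inv R \_ D.
  apply/funext => x; rewrite /patch; case: ifPn => // /negP.
  rewrite inE /D /= => /contrapT ->.
  by rewrite invr0.
have oD : open D by apply: closed_openC; exact: closed_eq.
apply/(measurable_restrictT _ _).1; first exact: open_measurable.
apply: open_continuous_measurable_fun => // x; rewrite inE => /eqP x0.
exact: inv_continuous.
Qed.

Section duality.
Context {R : realType}.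
Local Notation mu := (@lebesgue_measure R).
Local Notation V := 'rV[R]_3.
Implicit Types (th ph al be q sg : R) (K : V -> V -> R).

(** An integral over pairs of orthogonal unit vectors [x = spherical (th, ph)] and
    [e], with respect to [dal] on the half circle of the [e] and then to the area
    [sin th dth dph] of [x]. *)
Definition flag_int sg K : \bar R :=
  (\int[mu]_(th in `]0%R, pi[) \int[mu]_(ph in `[0%R, (2 * pi)%R])
   \int[mu]_(al in `]0%R, pi[)
     (K (spherical (th, ph)) (conormal sg th ph al) * sin th)%:E)%E.

Definition sphere2_continuous K := forall x e, x != 0 -> e != 0 ->
  {for (x, e), continuous (fun p : V * V => K p.1 p.2)}.

Lemma sphere2_continuous_swap K :
  sphere2_continuous K -> sphere2_continuous (fun x e => K e x).
Proof.
move=> cK x e x0 e0.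
have f1 : fst @ nbhs (x, e) --> nbhs x by exact: cvg_fst.
have f2 : snd @ nbhs (x, e) --> nbhs e by exact: cvg_snd.
exact: (cvg_comp2 f2 f1 (cK e x e0 x0)).
Qed.

(** The density of [flag_int] when [e] is described by [cos be = e_3] in place of
    [al]: from [cos be = sin th * cos al] follows
    [dal = sin be / sqrt (sin th ^ 2 - cos be ^ 2) dbe], and the root is symmetric
    in [th] and [be]. *)
Definition flag_density sg K th be ph : R :=
  if cos be ^+ 2 < sin th ^+ 2 then
    K (spherical (th, ph)) (conormal_at sg th ph (cos be)) * sin th * sin be /
      Num.sqrt (sin th ^+ 2 - cos be ^+ 2) else 0.

Lemma flag_density_ge0 sg K th be ph : (forall x e, 0 <= K x e) ->
  0 < th < pi -> 0 < be < pi -> 0 <= flag_density sg K th be ph.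
Proof.
move=> K0 /sin_gt0_pi/ltW th0 /sin_gt0_pi/ltW be0; rewrite /flag_density.
case: ifP => // _; apply: divr_ge0; last exact: sqrtr_ge0.
by do 2 (apply: mulr_ge0 => //).
Qed.

Lemma flag_density_continuous_ph sg K th be : sg ^+ 2 = 1 ->
  sphere2_continuous K -> 0 < th < pi ->
  continuous (flag_density sg K th be).
Proof.
move=> sg2 cK thI ph; rewrite /flag_density.
case: (cos be ^+ 2 < sin th ^+ 2); last exact: cvg_cst.
apply: cvgM; last exact: cvg_cst.
apply: cvgM; last exact: cvg_cst.
apply: cvgM; last exact: cvg_cst.
apply: (@continuous_comp2 _ _ K (fun ph => spherical (th, ph))
  (fun ph => conormal_at sg th ph (cos be))).
- by apply: cK; [exact: spherical_neq0|exact: conormal_at_neq0].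
- exact: continuous_spherical_ph.
- exact: continuous_conormal_at_ph.
Qed.

Lemma flag_int_inner sg K th ph : sg ^+ 2 = 1 -> (forall x e, 0 <= K x e) ->
  sphere2_continuous K -> 0 < th < pi ->
  (\int[mu]_(al in `]0%R, pi[)
     (K (spherical (th, ph)) (conormal sg th ph al) * sin th)%:E =
   \int[mu]_(be in `]0%R, pi[) (flag_density sg K th be ph)%:E)%E.
Proof.
move=> sg2 K0 cK thI; have th0 := sin_gt0_pi thI.
pose g q := K (spherical (th, ph)) (conormal_at sg th ph q) * sin th.
transitivity (\int[mu]_(al in `]0%R, pi[) (g (sin th * cos al)%R)%:E)%E.
  apply: eq_integral => al; rewrite inE /= in_itv /= => alI.
  by rewrite /g conormal_atE.
rewrite cos_substitution_singular.
- by apply: eq_integral => be _; rewrite /flag_density /g; case: ifP => // _.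
- move=> q; apply: cvgM; last exact: cvg_cst.
  apply: (@continuous_comp2 _ _ K (fun _ => spherical (th, ph))
    (conormal_at sg th ph)).
  + by apply: cK; [exact: spherical_neq0|exact: conormal_at_neq0].
  + exact: cvg_cst.
  + exact: continuous_conormal_at_q.
- by move=> q; rewrite mulr_ge0 // ltW.
- by rewrite th0 sin_le1.
Qed.

(** Both densities describe the same pairs, up to a rotation about the third
    axis, and the integral over [ph] absorbs the rotation. *)
Lemma flag_density_swap sg K th be : sg ^+ 2 = 1 -> (forall x e, 0 <= K x e) ->
  sphere2_continuous K -> 0 < th < pi -> 0 < be < pi ->
  (\int[mu]_(ph in `[0%R, (2 * pi)%R]) (flag_density sg K th be ph)%:E =
   \int[mu]_(ph in `[0%R, (2 * pi)%R])
     (flag_density (- sg) (fun x e => K e x) be th ph)%:E)%E.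
Proof.
move=> sg2 K0 cK thI beI.
have cK' := sphere2_continuous_swap _ cK.
have cE : (cos th ^+ 2 < sin be ^+ 2) = (cos be ^+ 2 < sin th ^+ 2).
  by rewrite !sin2cos2 ltrBrDl ltrBrDl addrC.
have [hbt|hbt] := boolP (cos be ^+ 2 < sin th ^+ 2); last first.
  by apply: eq_integral => ph _; rewrite /flag_density cE (negbTE hbt).
have [psi psiI hpsi] := conormal_rotation sg th be sg2 thI beI hbt.
pose k := flag_density (- sg) (fun x e => K e x) be th.
rewrite -[RHS](@integral_periodic_shift _ k _ psi) //.
- apply: eq_integral => ph _; rewrite /k /flag_density cE hbt.
  have [-> ->] := hpsi ph; congr (_%:E).
  rewrite -!mulrA; congr (_ * _); rewrite mulrCA; congr (_ * (_ * _^-1)).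
  by congr Num.sqrt; rewrite !sin2cos2; ring.
- by apply: flag_density_continuous_ph => //; rewrite sqrrN.
- by move=> t; exact: flag_density_ge0.
- move=> t; rewrite /k /flag_density; case: ifP => // _.
  have -> : 2 * pi = pi *+ 2 :> R by rewrite mulr2n; ring.
  by rewrite /conormal_at !sphericalE cosD2pi sinD2pi.
Qed.

(** The cut-off keeps away from [sin th = 0], where [conormal_at] divides by
    zero. *)
Definition flag_density_in sg K (p : R * (R * R)) : R :=
  if (0 < p.2.1 < pi) && (0 < p.2.2 < pi) then flag_density sg K p.2.2 p.2.1 p.1
  else 0.

(** The density is continuous in [ph], and for fixed [ph] its essential factor is
    continuous in [be] and, on the open interval, in [th]; so
    [measurable_caratheodory] applies twice. *)
Lemma measurable_flag_density sg K : sg ^+ 2 = 1 -> sphere2_continuous K ->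
  measurable_fun setT (flag_density_in sg K).
Proof.
move=> sg2 cK.
pose I : set R := `]0, pi[%classic.
pose Kp ph be th : R :=
  (fun th => K (spherical (th, ph)) (conormal_at sg th ph (cos be))) \_ I th.
pose w (t : R * R) : R := if (0 < t.1 < pi) && (cos t.1 ^+ 2 < sin t.2 ^+ 2) then
  sin t.2 * sin t.1 / Num.sqrt (sin t.2 ^+ 2 - cos t.1 ^+ 2) else 0.
pose h ph (t : R * R) : R :=
  if (0 < t.2 < pi) then Kp ph t.1 t.2 * w t else 0.
have -> : flag_density_in sg K = fun p => h p.1 p.2.
  apply/funext => -[ph [be th]]; rewrite /flag_density_in /h /w /Kp /patch /=.
  have [thI|] := boolP (0 < th < pi); last by rewrite andbF.
  rewrite andbT mem_set //=; case: ifP => // beI /=.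
    by rewrite /flag_density; case: ifP => _; rewrite ?mulr0 // !mulrA.
  by rewrite mulr0.
have mcos : measurable_fun setT (@cos R) by apply: continuous_measurable_fun; exact: continuous_cos.
have msin : measurable_fun setT (@sin R) by apply: continuous_measurable_fun; exact: continuous_sin.
apply: measurable_caratheodory => [[be th] /=|ph].
  rewrite /h /=; case: (boolP (0 < th < pi)) => thI ph; last exact: cvg_cst.
  apply: cvgM; last exact: cvg_cst.
  have thI' : th \in I by rewrite inE /I /= in_itv.
  rewrite /Kp /patch thI'.
  apply: (@continuous_comp2 _ _ K (fun ph => spherical (th, ph))
    (fun ph => conormal_at sg th ph (cos be))).
  - by apply: cK; [exact: spherical_neq0|exact: conormal_at_neq0].
  - exact: continuous_spherical_ph.
  - exact: continuous_conormal_at_ph.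
rewrite /h.
have mI (f : R * R -> R) : measurable_fun setT f ->
    measurable_fun setT (fun t => 0 < f t < pi).
  by move=> mf; apply: measurable_and; apply: measurable_fun_ltr.
apply: measurable_fun_ifT; [exact: mI|apply: measurable_funM|exact: measurable_cst].
- apply: (measurable_caratheodory _ _ _ (Kp ph)) => [th|be].
  + rewrite /Kp /patch; case: (boolP (th \in I)) => [|_]; last exact: cst_continuous.
    rewrite inE /I /= in_itv /= => thI be.
    apply: (@continuous_comp2 _ _ K (fun _ => spherical (th, ph))
      (fun be => conormal_at sg th ph (cos be))).
    * by apply: cK; [exact: spherical_neq0|exact: conormal_at_neq0].
    * exact: cvg_cst.
    * apply: (@continuous_comp _ _ _ (@cos R)); first exact: continuous_cos.
      exact: continuous_conormal_at_q.
  + apply/(measurable_restrictT _ _).1; first exact: measurable_itv.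
    apply: open_continuous_measurable_fun; first exact: interval_open.
    move=> th; rewrite inE /I /= in_itv /= => thI.
    apply: (@continuous_comp2 _ _ K (fun th => spherical (th, ph))
      (fun th => conormal_at sg th ph (cos be))).
    * by apply: cK; [exact: spherical_neq0|exact: conormal_at_neq0].
    * exact: continuous_spherical_th.
    * exact: continuous_conormal_at_th.
- rewrite /w.
  have mc : measurable_fun setT (fun t : R * R => cos t.1) by exact: measurableT_comp.
  have ms : measurable_fun setT (fun t : R * R => sin t.2) by exact: measurableT_comp.
  apply: measurable_fun_ifT; last exact: measurable_cst.
  + apply: measurable_and; first exact: mI.
    by apply: measurable_fun_ltr; exact: measurable_funX.
  + apply: measurable_funM.
      by apply: measurable_funM => //; exact: measurableT_comp.
    apply: (@measurableT_comp _ _ _ _ _ _ (@GRing.inv R)).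
      exact: measurable_inv.
    apply: (@measurableT_comp _ _ _ _ _ _ (@Num.sqrt R)).
      by apply: continuous_measurable_fun; exact: sqrt_continuous.
    by apply: measurable_funB; exact: measurable_funX.
Qed.


Lemma measurable_flag_slice sg K th : sg ^+ 2 = 1 -> sphere2_continuous K ->
  measurable_fun setT (fun p : R * R => flag_density_in sg K (p.1, (p.2, th))).
Proof.
move=> sg2 cK.
apply: (measurableT_comp (measurable_flag_density sg K sg2 cK)).
by apply: measurable_fun_pair => //; apply: measurable_fun_pair.
Qed.

Lemma flag_density_in_ge0 sg K p : (forall x e, 0 <= K x e) ->
  0 <= flag_density_in sg K p.
Proof.
move=> K0; rewrite /flag_density_in; case: ifP => // /andP[beI thI].
exact: flag_density_ge0.
Qed.

Lemma flag_intE sg K : sg ^+ 2 = 1 -> (forall x e, 0 <= K x e) ->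
  sphere2_continuous K ->
  (flag_int sg K = \int[mu]_(th in `]0%R, pi[) \int[mu]_(be in `]0%R, pi[)
    \int[mu]_(ph in `[0%R, (2 * pi)%R]) (flag_density_in sg K (ph, (be, th)))%:E)%E.
Proof.
move=> sg2 K0 cK; apply: eq_integral => th; rewrite inE /= in_itv /= => thI.
have mI : measurable (`]0, pi[%classic : set R) by exact: measurable_itv.
have mJ : measurable (`[0, 2 * pi]%classic : set R) by exact: measurable_itv.
pose F (p : R * R) := (flag_density_in sg K (p.1, (p.2, th)))%:E.
have F0 (p : R * R) : `[0, 2 * pi]%classic p.1 -> `]0, pi[%classic p.2 -> (0 <= F p)%E.
  by move=> _ _; rewrite lee_fin flag_density_in_ge0.
have mF : measurable_fun (`[0, 2 * pi]%classic `*` `]0, pi[%classic) F.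
  by apply/measurable_EFinP/measurable_funTS; exact: measurable_flag_slice.
apply: etrans (tonelli_rect _ _ _ _ _ mu mu _ _ F mJ mI F0 mF).
apply: eq_integral => ph _; rewrite flag_int_inner //.
apply: eq_integral => be; rewrite inE /= in_itv /= => beI.
by rewrite /F /flag_density_in /= beI thI.
Qed.

(** Both sides integrate over the same orthonormal pairs with respect to the same
    rotation-invariant measure.  In the coordinates [th] and [be], the colatitudes
    of the two vectors, exchanging the vectors amounts to exchanging the two
    integrations, up to the rotation of [flag_density_swap]. *)
Theorem flag_int_swap sg K : sg ^+ 2 = 1 -> (forall x e, 0 <= K x e) ->
  sphere2_continuous K ->
  flag_int sg K = flag_int (- sg) (fun x e => K e x).
Proof.
move=> sg2 K0 cK.
have cK' := sphere2_continuous_swap _ cK.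
have mf := measurable_flag_density sg K sg2 cK.
have sgN2 : (- sg) ^+ 2 = 1 by rewrite sqrrN.
rewrite (flag_intE sg K sg2 K0 cK).
rewrite (flag_intE (- sg) (fun x e => K e x) sgN2 (fun x e => K0 e x) cK').
pose F (p : R * R) : \bar R := (\int[mu]_(ph in `[0%R, (2 * pi)%R])
  (flag_density_in sg K (ph, (p.2, p.1)))%:E)%E.
have F0 p : (0 <= F p)%E.
  by apply: integral_ge0 => ph _; rewrite lee_fin flag_density_in_ge0.
have mF : measurable_fun setT F.
  pose J : set R := `[0, 2 * pi]%classic.
  pose G (p : R * (R * R)) : \bar R :=
    ((EFin \o flag_density_in sg K) \_ (J `*` setT)) p.
  have mG : measurable_fun setT G.
    apply/(measurable_restrictT _ _).1.
      by apply: measurableX => //; exact: measurable_itv.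
    by apply/measurable_funTS/measurable_EFinP.
  have G0 p : (0 <= G p)%E.
    by apply: erestrict_ge0 => q _; rewrite lee_fin flag_density_in_ge0.
  have := measurable_fun_fubini_tonelli_G (m1 := mu) G mG G0.
  rewrite /fubini_G => mH.
  have -> : F = (fun p => \int[mu]_x G (x, p))%E \o (fun p => (p.2, p.1)).
    apply/funext => p; rewrite /F /= integral_mkcond; apply: eq_integral => ph _.
    by rewrite /G /patch in_setX in_setT andbT.
  apply: (measurableT_comp mH).
  by apply: measurable_fun_pair.
have mI : measurable (`]0, pi[%classic : set R) by exact: measurable_itv.
apply: etrans; first exact: (tonelli_rect _ _ _ _ _ mu mu _ _ F mI mI
  (fun p _ _ => F0 p) (measurable_funTS mF)).
apply: eq_integral => be; rewrite inE /= in_itv /= => beI.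
apply: eq_integral => th; rewrite inE /= in_itv /= => thI.
rewrite /F /flag_density_in /= thI beI /=.
exact: flag_density_swap.
Qed.

End duality.

(** * A Wirtinger inequality on half a great circle *)

Section wirtinger.
Context {R : realType}.
Local Notation mu := (@lebesgue_measure R).

Lemma is_derive_continuous (F : R -> R) (t f : R) :
  is_derive t 1 F f -> {for t, continuous F}.
Proof. by case=> /derivable1_diffP/differentiable_continuous. Qed.

Lemma is_derive_unique (F : R -> R) (t f f' : R) :
  is_derive t 1 F f -> is_derive t 1 F f' -> f = f'.
Proof. by case=> _ <- [_ <-]. Qed.

Lemma is_derive_pt_eq (F : R -> R) (t f f' : R) :
  is_derive t 1 F f' -> f' = f -> is_derive t 1 F f.
Proof. by move=> ? <-. Qed.
Arguments is_derive_pt_eq {F t f f'} _ _.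

Lemma is_derive_ptC (c t : R) : is_derive t 1 (fun _ : R => c) 0.
Proof. exact: is_derive_cst. Qed.

Lemma is_derive_ptD (F G : R -> R) (t f g : R) :
  is_derive t 1 F f -> is_derive t 1 G g ->
  is_derive t 1 (fun t => F t + G t) (f + g).
Proof. by move=> dF dG; exact: is_deriveD. Qed.
Arguments is_derive_ptD {F G t f g} _ _.

Lemma is_derive_ptM (F G : R -> R) (t f g : R) :
  is_derive t 1 F f -> is_derive t 1 G g ->
  is_derive t 1 (fun t => F t * G t) (f * G t + F t * g).
Proof.
move=> dF dG; apply: (is_derive_pt_eq (is_deriveM dF dG)).
by rewrite /GRing.scale /= addrC [f * _]mulrC.
Qed.
Arguments is_derive_ptM {F G t f g} _ _.

Lemma is_derive_ptZ (F : R -> R) (c t f : R) :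
  is_derive t 1 F f -> is_derive t 1 (fun t => c * F t) (c * f).
Proof.
move=> dF; apply: (is_derive_pt_eq (is_derive_ptM (is_derive_ptC c t) dF)).
by rewrite mul0r add0r.
Qed.
Arguments is_derive_ptZ {F} c {t f} _.

Lemma is_derive_ptcomp (F G : R -> R) (t f g : R) :
  is_derive (G t) 1 F f -> is_derive t 1 G g ->
  is_derive t 1 (fun t => F (G t)) (f * g).
Proof. by move=> dF dG; exact: is_derive1_comp. Qed.
Arguments is_derive_ptcomp F G {t f g} _ _.

Lemma is_derive_translate (F : R -> R) (s t f : R) :
  is_derive (t + s) 1 F f -> is_derive t 1 (fun t => F (t + s)) f.
Proof.
move=> dF; apply: (is_derive_pt_eq (is_derive_ptcomp F (fun t => t + s) dF
  (is_derive_shift t 1 s))).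
by rewrite mulr1.
Qed.

Lemma is_derive_periodic (F f : R -> R) (T : R) :
  (forall t : R, is_derive t 1 F (f t)) -> (forall t, F (t + T) = F t) ->
  forall t, f (t + T) = f t.
Proof.
move=> dF FT t; apply: (@is_derive_unique F t) => //.
have := is_derive_translate F T t _ (dF (t + T)).
by under eq_fun do rewrite FT.
Qed.

Lemma Rintegral_itv_ge_primitive (e1 e2 P p : R -> R) (x y : R) : x <= y ->
  continuous e1 -> continuous e2 ->
  (forall t, x <= t <= y -> is_derive t 1 P (p t)) ->
  {within `[x, y], continuous p} ->
  (forall t, x <= t <= y -> p t <= e1 t - e2 t) ->
  P y - P x <= Rintegral mu `[x, y] e1 - Rintegral mu `[x, y] e2.
Proof.
move=> xy c1 c2 dP cp ple.
have int (h : R -> R) : {within `[x, y], continuous h} ->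
    mu.-integrable `[x, y] (EFin \o h).
  by move=> ch; apply: continuous_compact_integrable => //; exact: segment_compact.
have int1 := int _ (continuous_subspaceT c1).
have int2 := int _ (continuous_subspaceT c2).
have int3 := int _ cp.
rewrite -RintegralB //.
have -> : P y - P x = Rintegral mu `[x, y] p.
  by rewrite /Rintegral (FTC2 _ _ _ _ xy dP cp).
have int12 : mu.-integrable `[x, y] (EFin \o (fun t => e1 t - e2 t)).
  exact: (integrableB _ int1 int2).
exact: le_Rintegral.
Qed.

Variables (v v1 v2 : R -> R).
Hypothesis dv : forall t : R, is_derive t 1 v (v1 t).
Hypothesis dv1 : forall t : R, is_derive t 1 v1 (v2 t).
Hypothesis cv2 : continuous v2.
Hypothesis v_periodic : forall t, v (t + pi) = v t.

(* The solution [cos (k t)] of [y'' = - k^2 y] has no zero on [- pi/4, pi/4]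
   because [k < 2]; this keeps the function [tan (k t)] below regular.  At
   [k = 2] it would have poles at the ends of the interval. *)
Let k : R := Num.sqrt (15 / 4).
Let k2 : k ^+ 2 = 15 / 4. Proof. by rewrite sqr_sqrtr //; lra. Qed.
Let k0 : 0 <= k. Proof. exact: sqrtr_ge0. Qed.
Let k_lt2 : k < 2. Proof.
rewrite ltNge; apply/negP => h.
have : 2 * 2 <= k * k by apply: ler_pM.
by rewrite -[k * k]expr2 k2; lra.
Qed.

Let g t := expR (v t / 2).
Let w t := g t * v1 t / 2.
Let gE t : expR (v t) = g t ^+ 2.
Proof. by rewrite /g -expRM_natl; congr expR; field. Qed.
Let g0 t : 0 < g t. Proof. exact: expR_gt0. Qed.

Let dg (t : R) : is_derive t 1 g (w t).
Proof.
apply: (is_derive_pt_eq (is_derive_ptcomp expR (fun t => v t * 2^-1)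
  (is_derive_expR _) (is_derive_ptM (dv t) (is_derive_ptC _ t)))).
by rewrite /w /g; field.
Qed.

Let w1 t := g t * (v1 t ^+ 2 / 4 + v2 t / 2).
Let dw (t : R) : is_derive t 1 w (w1 t).
Proof.
apply: (is_derive_pt_eq (is_derive_ptM (is_derive_ptM (dg t) (dv1 t))
  (is_derive_ptC 2^-1 t))).
by rewrite /w1 /w; field.
Qed.

Let cont (F f : R -> R) : (forall t : R, is_derive t 1 F (f t)) -> continuous F.
Proof. by move=> dF t; exact: is_derive_continuous (dF t). Qed.
Let cv1 := cont _ _ dv1.
Let cg := cont _ _ dg.
Let cw := cont _ _ dw.
Let cw1 : continuous w1.
Proof.
move=> t; apply: cvgM; first exact: cg.
apply: cvgD; (apply: cvgM; last exact: cvg_cst); last exact: cv2.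
by apply: cvgM; exact: cv1.
Qed.

Let v1_periodic : forall t, v1 (t + pi) = v1 t := is_derive_periodic _ _ _ dv v_periodic.
Let v2_periodic : forall t, v2 (t + pi) = v2 t := is_derive_periodic _ _ _ dv1 v1_periodic.
Let g_periodic t : g (t + pi) = g t. Proof. by rewrite /g v_periodic. Qed.
Let w_periodic t : w (t + pi) = w t. Proof. by rewrite /w g_periodic v1_periodic. Qed.

(** The difference [w t - w (t + pi / 2)] takes opposite values at [0] and at
    [pi / 2]. *)
Lemma half_period_coincidence : exists a, w (a + pi / 2) = w a /\ 0 <= a <= pi.
Proof.
pose d t := w t - w (t + pi / 2).
have cd : continuous d.
  move=> t; apply: cvgB; first exact: cw.
  apply: (@continuous_comp _ _ _ (fun t => t + pi / 2) w); last exact: cw.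
  by apply: cvgD; [exact: cvg_id|exact: cvg_cst].
have dN : d (pi / 2) = - d 0.
  have wpi : w pi = w 0 by rewrite -[X in w X = _]add0r w_periodic.
  by rewrite /d add0r -splitr wpi opprB.
have h0 : 0 <= pi / 2 :> R by rewrite divr_ge0 // pi_ge0.
have [|a /[!in_itv]/= /andP[a0 a1] da] :=
    @IVT R d 0 (pi / 2) 0 h0 (continuous_subspaceT cd).
  rewrite dN ge_min le_max; case: (lerP (d 0) 0) => h /=.
    by rewrite oppr_ge0 h orbT.
  by rewrite oppr_le0 (ltW h).
exists a; split; first by apply/esym/eqP; rewrite -subr_eq0 -/(d a) da.
rewrite a0 (le_trans a1) // ler_pdivrMr // ler_peMr ?pi_ge0 //.
by rewrite ler1n.
Qed.

Let e1 t := expR (v t) * v2 t ^+ 2.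
Let e2 t := 15 / 4 * (expR (v t) * v1 t ^+ 2).

Let ce1 : continuous e1.
Proof.
have -> : e1 = fun t => g t ^+ 2 * v2 t ^+ 2 by apply/funext => t; rewrite /e1 gE.
by move=> t; apply: cvgM; apply: cvgM; do ?[exact: cg|exact: cv2].
Qed.

Let ce2 : continuous e2.
Proof.
have -> : e2 = fun t => 15 / 4 * (g t ^+ 2 * v1 t ^+ 2).
  by apply/funext => t; rewrite /e2 gE.
move=> t; apply: cvgM; first exact: cvg_cst.
by apply: cvgM; apply: cvgM; do ?[exact: cg|exact: cv1].
Qed.

(** With [e1 = exp(v) v''^2], [e2 = 15/4 exp(v) v'^2] and [w = g'], one has
      [e1 = 4 w'^2 + g^2 v'^4 / 12 - (g^2 v'^3)' / 3] and [e2 = 15 w^2],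
    where [w^2 = (w - c)^2 + 2 c w - c^2].  The last term of [P] comes from the
    first formula, the middle terms from [2 c w - c^2], and the term with the
    tangent is the one whose derivative differs from [4 w'^2 - 15 (w - c)^2] by a
    square, as in Jacobi's treatment of the Dirichlet problem. *)
Let P (c m t : R) : R :=
  - 4 * k * ((w t - c) ^+ 2 * tan (k * (t - m))) + - 30 * c * g t +
  15 * c ^+ 2 * t + - (3^-1) * (g t ^+ 2 * v1 t ^+ 3).
Let p (c m t : R) : R :=
  - 4 * k * (2 * (w t - c) * w1 t * tan (k * (t - m)) +
    (w t - c) ^+ 2 * (k * (1 + tan (k * (t - m)) ^+ 2))) + - 30 * c * w t +
  15 * c ^+ 2 + - (3^-1) *
    (2 * g t * w t * v1 t ^+ 3 + g t ^+ 2 * (3 * v1 t ^+ 2 * v2 t)).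

Let cos_neq0 m t : m - pi / 4 <= t <= m + pi / 4 -> cos (k * (t - m)) != 0.
Proof.
move=> tm; rewrite gt_eqF //; apply: cos_gt0_pihalf; rewrite -ltr_norml.
have pi0 := pi_gt0 R.
have h : `|t - m| <= pi / 4 by rewrite ler_norml; move: tm; lra.
rewrite normrM (ger0_norm k0) (le_lt_trans (ler_wpM2l k0 h)) //.
move: k_lt2 pi0 => ? ?; rewrite -subr_gt0.
have -> : pi / 2 - k * (pi / 4) = (2 - k) * (pi / 4) by field.
by rewrite mulr_gt0 // ?subr_gt0 // divr_gt0.
Qed.

Let dT (m t : R) : cos (k * (t - m)) != 0 ->
  is_derive t 1 (fun t => tan (k * (t - m))) (k * (1 + tan (k * (t - m)) ^+ 2)).
Proof.
move=> h.
apply: (is_derive_pt_eq (is_derive_ptcomp tan (fun t => k * (t - m))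
  (is_derive_tan h) (is_derive_ptZ k (is_derive_ptD (is_derive_id t 1)
  (is_derive_ptC (- m) t))))).
by rewrite cos2_tan2 //; ring.
Qed.

Let cp c m (t : R) : m - pi / 4 <= t <= m + pi / 4 -> {for t, continuous (p c m)}.
Proof.
move=> /cos_neq0/(dT m)/is_derive_continuous cT.
have cX (F : R -> R) n : {for t, continuous F} -> {for t, continuous (fun t => F t ^+ n)}.
  move=> cF; apply: (@continuous_comp _ _ _ F (fun x => x ^+ n)) => //.
  exact: exprn_continuous.
have wc : {for t, continuous (fun t => w t - c)}.
  by apply: cvgB; [exact: cw|exact: cvg_cst].
have T2 := cX _ 2 cT.
have g2 := cX _ 2 (cg t).
have v12 := cX _ 2 (cv1 t).
have v13 := cX _ 3 (cv1 t).
have wc2 := cX _ 2 wc.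
rewrite /p; apply: cvgD; last first.
  apply: cvgM; first exact: cvg_cst.
  apply: cvgD.
    apply: cvgM; last exact: v13.
    apply: cvgM; last exact: cw.
    by apply: cvgM; [exact: cvg_cst|exact: cg].
  apply: cvgM; first exact: g2.
  apply: cvgM; last exact: cv2.
  by apply: cvgM; [exact: cvg_cst|exact: v12].
apply: cvgD; last exact: cvg_cst.
apply: cvgD; last first.
  by apply: cvgM; [exact: cvg_cst|exact: cw].
apply: cvgM; first exact: cvg_cst.
apply: cvgD.
  apply: cvgM; last exact: cT.
  apply: cvgM; last exact: cw1.
  by apply: cvgM; [exact: cvg_cst|exact: wc].
apply: cvgM; first exact: wc2.
apply: cvgM; first exact: cvg_cst.
by apply: cvgD; [exact: cvg_cst|exact: T2].
Qed.

Let dP c m (t : R) : m - pi / 4 <= t <= m + pi / 4 -> is_derive t 1 (P c m) (p c m t).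
Proof.
move=> /cos_neq0 h; rewrite /P.
have dT0 := dT m t h.
have dX (F : R -> R) f : is_derive t 1 F f -> is_derive t 1 (fun t => F t ^+ 2) (2 * F t * f).
  move=> dF; under eq_fun do rewrite expr2.
  by apply: (is_derive_pt_eq (is_derive_ptM dF dF)); ring.
have dX3 (F : R -> R) f : is_derive t 1 F f -> is_derive t 1 (fun t => F t ^+ 3) (3 * F t ^+ 2 * f).
  move=> dF; under eq_fun do rewrite exprS.
  by apply: (is_derive_pt_eq (is_derive_ptM dF (dX _ _ dF))); ring.
have dwc : is_derive t 1 (fun t => w t - c) (w1 t + 0).
  exact: (is_derive_ptD (dw t) (is_derive_ptC (- c) t)).
have d1 := is_derive_ptZ (- 4 * k) (is_derive_ptM (dX _ _ dwc) dT0).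
have d2 := is_derive_ptZ (- 30 * c) (dg t).
have d3 := is_derive_ptZ (15 * c ^+ 2) (is_derive_id t 1).
have d4 := is_derive_ptZ (- 3^-1) (is_derive_ptM (dX _ _ (dg t)) (dX3 _ _ (dv1 t))).
apply: (is_derive_pt_eq (is_derive_ptD (is_derive_ptD (is_derive_ptD d1 d2) d3) d4)).
by rewrite /p; ring.
Qed.

Let p_le c m t : p c m t <= e1 t - e2 t.
Proof.
(* [4 k^2 = 15] is used only after completing the square *)
rewrite -subr_ge0 /p /e1 /e2 gE.
set T := tan _.
have -> : g t ^+ 2 * v2 t ^+ 2 - 15 / 4 * (g t ^+ 2 * v1 t ^+ 2) -
  (- 4 * k * (2 * (w t - c) * w1 t * T + (w t - c) ^+ 2 * (k * (1 + T ^+ 2))) +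
   - 30 * c * w t + 15 * c ^+ 2 + - 3^-1 *
   (2 * g t * w t * v1 t ^+ 3 + g t ^+ 2 * (3 * v1 t ^+ 2 * v2 t))) =
  4 * (w1 t + k * (w t - c) * T) ^+ 2 + 12^-1 * (g t * v1 t ^+ 2) ^+ 2 +
  4 * (k ^+ 2 - 15 / 4) * (w t - c) ^+ 2.
  by rewrite /w1 /w; field.
rewrite k2 subrr mulr0 mul0r addr0 addr_ge0 // mulr_ge0 ?sqr_ge0 //.
Qed.

(** On each half of a period, between the two points where [w] takes the value
    [c], the integral of [e1 - e2] is at least the increase of [P]; there the
    tangent term vanishes at both ends.  Over the whole period the periodic terms
    cancel and [15 c^2 pi] is left. *)
Lemma half_circle_wirtinger :
  (\int[mu]_(t in `[0%R, pi]) (15 / 4 * (expR (v t) * v1 t ^+ 2))%:E <=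
   \int[mu]_(t in `[0%R, pi]) (expR (v t) * v2 t ^+ 2)%:E)%E.
Proof.
have [a [wa a0pi]] := half_period_coincidence.
have e10 t : 0 <= e1 t by rewrite mulr_ge0 ?expR_ge0 ?sqr_ge0.
have e20 t : 0 <= e2 t by rewrite mulr_ge0 // mulr_ge0 ?expR_ge0 ?sqr_ge0.
have e1p t : e1 (t + pi) = e1 t by rewrite /e1 v_periodic v2_periodic.
have e2p t : e2 (t + pi) = e2 t by rewrite /e2 v_periodic v1_periodic.
have pi0 := pi_gt0 R.
have int (e : R -> R) x y : continuous e -> mu.-integrable `[x, y] (EFin \o e).
  move=> ce; apply: continuous_compact_integrable; first exact: segment_compact.
  exact: continuous_subspaceT.
have half c m : w (m - pi / 4) = c -> w (m + pi / 4) = c ->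
    15 * c ^+ 2 * (pi / 2) - 30 * c * (g (m + pi / 4) - g (m - pi / 4)) -
    3^-1 * (g (m + pi / 4) ^+ 2 * v1 (m + pi / 4) ^+ 3 -
            g (m - pi / 4) ^+ 2 * v1 (m - pi / 4) ^+ 3) <=
    Rintegral mu `[m - pi / 4, m + pi / 4] e1 - Rintegral mu `[m - pi / 4, m + pi / 4] e2.
  move=> wm wp.
  pose x := m - pi / 4; pose y := m + pi / 4.
  have -> : 15 * c ^+ 2 * (pi / 2) - 30 * c * (g y - g x) -
    3^-1 * (g y ^+ 2 * v1 y ^+ 3 - g x ^+ 2 * v1 x ^+ 3) = P c m y - P c m x.
    by rewrite /P wm wp /x /y; field.
  have xy : x <= y by rewrite /x /y; move: pi0; lra.
  have cxy : {within `[x, y], continuous (p c m)}.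
    by apply: continuous_in_subspaceT => t; rewrite inE /= in_itv /=; exact: cp.
  exact: (Rintegral_itv_ge_primitive e1 e2 _ _ _ _ xy ce1 ce2
    (fun t h => dP c m t h) cxy (fun t _ => p_le c m t)).
pose c := w a.
have h1 := half c (a + pi / 4).
have h2 := half c (a + pi / 2 + pi / 4).
have E1 : a + pi / 4 - pi / 4 = a by field.
have E2 : a + pi / 4 + pi / 4 = a + pi / 2 by field.
have E3 : a + pi / 2 + pi / 4 - pi / 4 = a + pi / 2 by field.
have E4 : a + pi / 2 + pi / 4 + pi / 4 = a + pi by field.
rewrite E1 E2 in h1; rewrite E3 E4 in h2.
have {h1} := h1 erefl wa; have {h2} := h2 wa (w_periodic a).
rewrite g_periodic v1_periodic => h2 h1.
have cat (e : R -> R) : continuous e -> (forall t, 0 <= e t) -> (forall t, e (t + pi) = e t) ->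
    Rintegral mu `[a, a + pi / 2] e + Rintegral mu `[a + pi / 2, a + pi] e =
    Rintegral mu `[0, pi] e.
  move=> ce ege0 eT.
  rewrite /Rintegral -fineD; [|exact: integrable_fin_num (int _ _ _ ce)..].
  rewrite -integral_itv_cat //.
  - by rewrite -{1}[a]add0r [a + pi]addrC integral_shift ?integral_periodic_shift // ltW.
  - by move: pi0; lra.
  - by move: pi0; lra.
have fin (e : R -> R) : continuous e ->
    (\int[mu]_(t in `[0%R, pi]) (e t)%:E = (Rintegral mu `[0, pi] e)%:E)%E.
  by move=> ce; rewrite /Rintegral fineK //; exact: integrable_fin_num (int _ _ _ ce).
rewrite (fin e2 ce2) (fin e1 ce1) lee_fin.
rewrite -(cat e1 ce1 e10 e1p) -(cat e2 ce2 e20 e2p).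
rewrite -subr_ge0 [X in 0 <= X](_ : _ =
  (Rintegral mu `[a, a + pi / 2] e1 - Rintegral mu `[a, a + pi / 2] e2) +
  (Rintegral mu `[a + pi / 2, a + pi] e1 - Rintegral mu `[a + pi / 2, a + pi] e2)).
  apply: le_trans (lerD h1 h2).
  rewrite [X in 0 <= X](_ : _ = 15 * (c ^+ 2 * pi)); last by field.
  by rewrite mulr_ge0 // mulr_ge0 ?sqr_ge0 // ltW.
by rewrite addrACA opprD.
Qed.

End wirtinger.
Arguments is_derive_unique {R F t f f'} _ _.
Arguments is_derive_pt_eq {R F t f f'} _ _.
Arguments is_derive_ptC {R} c t.
Arguments is_derive_ptD {R F G t f g} _ _.
Arguments is_derive_ptM {R F G t f g} _ _.
Arguments is_derive_ptZ {R F} c {t f} _.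
Arguments is_derive_ptcomp {R} F G {t f g} _ _.

(** * Differentials of scalar functions on the ambient space *)

Section frechet.
Context {R : realType}.
Local Notation V := 'rV[R]_3.
Implicit Types (F G : V -> R) (x v : V).

(** The differential as an explicit map [L], so that the rules below compute it
    together with proving differentiability. *)
Definition fderiv F x (L : V -> R) :=
  differentiable F x /\ forall v, 'D_v F x = L v.

Lemma fderivE F x : differentiable F x -> fderiv F x (fun v => 'D_v F x).
Proof. by []. Qed.

Lemma fderiv_is_derive {F x L} v : fderiv F x L -> is_derive x v F (L v).
Proof.
by move=> [dF FL]; apply: DeriveDef; [exact: diff_derivable|exact: FL].
Qed.

Lemma fderiv_cst (c : R) x : fderiv (fun=> c) x (fun=> 0).
Proof.
by split => [|v]; [exact: differentiable_cst|exact: derive_cst].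
Qed.

Lemma fderiv_coord k x : fderiv (fun x => x 0 k) x (fun v => v 0 k).
Proof.
split => [|v]; first exact: differentiable_coord.
have := derive_mx (@derivable_id _ V x v).
by rewrite derive_id => /rowP/(_ k); rewrite mxE => ->.
Qed.

Lemma fderivD {F G x L M} : fderiv F x L -> fderiv G x M ->
  fderiv (fun x => F x + G x) x (fun v => L v + M v).
Proof.
move=> FL GM; split => [|v].
  by apply: differentiableD; [case: FL|case: GM].
by have [] := is_deriveD (fderiv_is_derive v FL) (fderiv_is_derive v GM).
Qed.

Lemma fderivM {F G x L M} : fderiv F x L -> fderiv G x M ->
  fderiv (fun x => F x * G x) x (fun v => L v * G x + F x * M v).
Proof.
move=> FL GM; split => [|v].
  by apply: differentiableM; [case: FL|case: GM].
have [_ ->] := is_deriveM (fderiv_is_derive v FL) (fderiv_is_derive v GM).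
by rewrite /GRing.scale /= addrC [G x * _]mulrC.
Qed.

Lemma fderiv_comp (h : R -> R) (dh : R) {F x L} : is_derive (F x) 1 h dh ->
  fderiv F x L -> fderiv (fun x => h (F x)) x (fun v => dh * L v).
Proof.
move=> hd [dF FL].
have dhF : differentiable h (F x) by apply/derivable1_diffP; case: hd.
split => [|v]; first exact: (differentiable_comp dF dhF).
rewrite deriveE; last exact: (differentiable_comp dF dhF).
rewrite diff_comp //= -(deriveE v dF) FL.
have {1}-> : L v = L v *: (1 : R) by rewrite /GRing.scale /= mulr1.
by rewrite linearZ -deriveE //; case: hd => _ ->; rewrite /GRing.scale /= mulrC.
Qed.

Lemma fderiv_eq {F x L M} : fderiv F x L -> L =1 M -> fderiv F x M.
Proof. by move=> [dF FL] LM; split => // v; rewrite FL LM. Qed.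

Lemma fderiv_curve {F L} (c : R -> V) (c' : V) (t : R) :
  fderiv F (c t) L -> is_derive t 1 c c' ->
  is_derive t 1 (fun t => F (c t)) (L c').
Proof.
move=> [dF FL] [dc <-].
have dc1 : differentiable c t by apply/derivable1_diffP.
have dFc : differentiable (F \o c) t by exact: differentiable_comp.
apply: DeriveDef; first exact: diff_derivable.
by rewrite deriveE // diff_comp //= -FL !deriveE.
Qed.

Lemma vec3_is_derive (x y z : R -> R) (t x' y' z' : R) :
  is_derive t 1 x x' -> is_derive t 1 y y' -> is_derive t 1 z z' ->
  is_derive t 1 (fun t => vec3 (x t) (y t) (z t)) (vec3 x' y' z').
Proof.
move=> dx dy dz.
have H (k : 'I_3) : is_derive t 1 (fun t => vec3 (x t) (y t) (z t) 0 k) (vec3 x' y' z' 0 k).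
  rewrite mxE (_ : (fun t => _) = fun t => [:: x t; y t; z t]`_k); last first.
    by apply/funext => s; rewrite mxE.
  by case: k => [[|[|[|//]]]] /=.
have D : derivable (fun t => vec3 (x t) (y t) (z t)) t 1.
  by apply/derivable_mxP => i k; rewrite ord1; case: (H k).
apply: DeriveDef => //; rewrite (derive_mx D); apply/rowP => k.
by rewrite [LHS]mxE; case: (H k).
Qed.

End frechet.

(** * Derivatives on the sphere through ambient extensions *)

Section normalization.
Context {R : realType}.
Local Notation V := 'rV[R]_3.
Implicit Types (F G : V -> R) (x v s : V).

Definition normalize x : V := (enorm x)^-1 *: x.

Lemma row3P (u v : V) : u 0 (inord 0) = v 0 (inord 0) ->
  u 0 (inord 1) = v 0 (inord 1) -> u 0 (inord 2) = v 0 (inord 2) -> u = v.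
Proof.
move=> h0 h1 h2; apply/rowP => -[[|[|[|//]]] hk].
- by rewrite (_ : Ordinal hk = inord 0) //; apply/val_inj; rewrite /= inordK.
- by rewrite (_ : Ordinal hk = inord 1) //; apply/val_inj; rewrite /= inordK.
- by rewrite (_ : Ordinal hk = inord 2) //; apply/val_inj; rewrite /= inordK.
Qed.

Lemma vec3_eta x : x = vec3 (x 0 (inord 0)) (x 0 (inord 1)) (x 0 (inord 2)).
Proof. by apply: row3P; rewrite vec3_coord. Qed.

Lemma dot_ge0 x : 0 <= dot x x.
Proof. by rewrite dotE !addr_ge0 // -expr2 sqr_ge0. Qed.

Lemma dot_eq0 x : (dot x x == 0) = (x == 0).
Proof.
apply/idP/eqP => [|->]; last by rewrite dotE !mxE !mul0r !addr0.
rewrite dotE !paddr_eq0 ?addr_ge0 -?expr2 ?sqr_ge0 // !sqrf_eq0.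
by move=> /andP[/andP[/eqP h0 /eqP h1] /eqP h2]; apply: row3P; rewrite mxE.
Qed.

Lemma enorm_gt0 x : x != 0 -> 0 < enorm x.
Proof. by move=> x0; rewrite sqrtr_gt0 lt_neqAle eq_sym dot_eq0 x0 dot_ge0. Qed.

Lemma S2E s : S2 s <-> dot s s = 1.
Proof.
rewrite /S2 /enorm /=; split => [h|->]; last by rewrite sqrtr1.
by rewrite -[dot s s]sqr_sqrtr ?dot_ge0 // h expr1n.
Qed.

Lemma S2_neq0 s : S2 s -> s != 0.
Proof. by move=> /S2E h; rewrite -dot_eq0 h oner_neq0. Qed.

Lemma dotZZ (a : R) x : dot (a *: x) (a *: x) = a ^+ 2 * dot x x.
Proof. by rewrite !dotE !mxE; ring. Qed.

Lemma S2_normalize x : x != 0 -> S2 (normalize x).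
Proof.
move=> x0; apply/S2E; rewrite dotZZ -[dot x x]sqr_sqrtr ?dot_ge0 // -/(enorm x).
by rewrite -exprMn mulVf ?expr1n // gt_eqF // enorm_gt0.
Qed.

Lemma normalize_S2 s : S2 s -> normalize s = s.
Proof. by rewrite /normalize => ->; rewrite invr1 scale1r. Qed.

Lemma dot_fderiv x : fderiv (fun x => dot x x) x (fun v => 2 * dot x v).
Proof.
rewrite (_ : (fun x : V => dot x x) = fun x => x 0 (inord 0) * x 0 (inord 0) +
  x 0 (inord 1) * x 0 (inord 1) + x 0 (inord 2) * x 0 (inord 2)); last first.
  by apply/funext => y; rewrite dotE.
have d k : fderiv (fun x => x 0 k * x 0 k) x (fun v => v 0 k * x 0 k + x 0 k * v 0 k).
  exact: fderivM (fderiv_coord k x) (fderiv_coord k x).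
apply: fderiv_eq (fderivD (fderivD (d _) (d _)) (d _)) _ => v /=.
by rewrite dotE; ring.
Qed.

Lemma enormV_fderiv x : x != 0 -> exists r : R,
  fderiv (fun x => (enorm x)^-1) x (fun v => r * dot x v).
Proof.
move=> x0; have e0 : 0 < dot x x by rewrite -sqrtr_gt0 enorm_gt0.
have ds : is_derive (dot x x) 1 (@Num.sqrt R) (2 * Num.sqrt (dot x x))^-1.
  exact: is_derive1_sqrt.
have n0 : Num.sqrt (dot x x) != 0 by rewrite gt_eqF // enorm_gt0.
have dV := is_deriveV n0 ds.
have := @fderiv_comp _ (fun r => (Num.sqrt r)^-1) _ (fun x => dot x x) x _ dV
  (dot_fderiv x).
set r := _ *: _ => h; exists (r * 2).
by apply: fderiv_eq h _ => v; rewrite mulrA.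
Qed.

Lemma normalize_differentiable x : x != 0 -> differentiable normalize x.
Proof.
move=> x0; have [r hr] := enormV_fderiv x x0.
rewrite (_ : normalize = fun y =>
  ((enorm y)^-1 * y 0 (inord 0)) *: basis_vec R 0 +
  ((enorm y)^-1 * y 0 (inord 1)) *: basis_vec R 1 +
  ((enorm y)^-1 * y 0 (inord 2)) *: basis_vec R (inord 2)); last first.
  apply/funext => y; rewrite -vec3E /normalize {2}(vec3_eta y).
  by apply: row3P; rewrite !mxE !inordK.
have d k : differentiable (fun y => (enorm y)^-1 * y 0 k) x.
  by have [] := fderivM hr (fderiv_coord k x).
by apply: differentiableD; [apply: differentiableD|]; exact: differentiableZl.
Qed.

Lemma normalize_continuous x : x != 0 -> {for x, continuous normalize}.
Proof. by move=> /normalize_differentiable/differentiable_continuous. Qed.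

(** The differential of [1 / |x|] at [s] is a multiple of [dot s], so that only
    the factor [x] of [x / |x|] contributes in a tangent direction. *)
Lemma normalize_derive s v : S2 s -> dot s v = 0 -> 'D_v normalize s = v.
Proof.
move=> ss sv0; have s0 := S2_neq0 s ss.
have [r hr] := enormV_fderiv s s0.
rewrite derive_mx; last exact/diff_derivable/normalize_differentiable.
apply/rowP => k; rewrite mxE.
rewrite (_ : (fun t => _) = fun y => (enorm y)^-1 * y 0 k); last first.
  by apply/funext => y; rewrite mxE.
have [_ ->] := fderivM hr (fderiv_coord k s).
by rewrite sv0 mulr0 mul0r add0r ss invr1 mul1r.
Qed.

Lemma near_neq0 x : x != 0 -> \forall y \near x, y != 0.
Proof.
move=> x0; have oD : open (~` [set (0 : V)]).
  apply: closed_openC; apply: accessible_closed_set1.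
  exact/hausdorff_accessible/norm_hausdorff.
have : open_nbhs x (~` [set (0 : V)]) by split => //; exact/eqP.
by move=> /open_nbhs_nbhs; apply: filterS => y /eqP.
Qed.

(** A function [h] on the sphere has the regularity [P] at [s] when it is the
    restriction near [s] of an ambient function [F] with this regularity.  The
    witness [F] is kept, since derivatives of [h] are computed from it. *)
Definition agree_on_S2 (P : (V -> R) -> V -> Prop) (h : V -> R) s F :=
  exists U : set V, [/\ open U, U s, P F s & forall x, U x -> S2 x -> F x = h x].

Lemma agree_near P h s F : S2 s -> agree_on_S2 P h s F ->
  {near s, F \o normalize =1 radial_ext h}.
Proof.
move=> ss [U [oU Us _ Fh]]; have s0 := S2_neq0 s ss.
near=> x => /=; apply: Fh; last by apply: S2_normalize; near: x; exact: near_neq0.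
near: x.
have cN : normalize y @[y --> s] --> s.
  by rewrite -[X in _ --> X](normalize_S2 s ss); exact: normalize_continuous.
by apply: cN; exact: open_nbhs_nbhs.
Unshelve. all: end_near. Qed.

(** Near [s], [radial_ext h] is [F o normalize], and the differential of
    [normalize] fixes tangent vectors. *)
Lemma radial_ext_derive h s F v : S2 s -> agree_on_S2 (fun F s => differentiable F s) h s F ->
  dot s v = 0 ->
  \sum_(k < 3) v 0 k * 'D_(basis_vec R k) (radial_ext h) s = 'D_v F s.
Proof.
move=> ss FU sv0; have s0 := S2_neq0 s ss.
have Fh := agree_near _ _ _ _ ss FU.
have [U [_ _ dF _]] := FU.
have dN := normalize_differentiable s s0.
have NE := normalize_S2 s ss.
have dF' : differentiable F (normalize s) by rewrite NE.
have dFN : differentiable (F \o normalize) s by exact: differentiable_comp.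
transitivity (\sum_(k < 3) v 0 k * 'd (F \o normalize) s (basis_vec R k)).
  apply: eq_bigr => k _; congr (_ * _).
  by rewrite -deriveE //; apply/esym/near_eq_derive.
transitivity ('d (F \o normalize) s v).
  rewrite {2}(row_sum_delta v) linear_sum; apply: eq_bigr => k _.
  by rewrite linearZ.
rewrite diff_comp //= NE -[X in 'd F s X = _]deriveE // normalize_derive //.
by rewrite deriveE.
Qed.

Lemma dot_b i s : dot s (b i s) = 0.
Proof.
rewrite dotE /b; case: i => [[|[|[|//]]]] hi /=; rewrite !vec3_coord; ring.
Qed.

(** [b i] differentiates along the sphere, so that any extension may be used. *)
Lemma bgradE i h s F : S2 s -> agree_on_S2 (fun F s => differentiable F s) h s F ->
  bgrad i h s = 'D_(b i s) F s.
Proof.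
move=> ss FU; rewrite -(radial_ext_derive h s F _ ss FU) ?dot_b //.
by rewrite /bgrad /dot /sgrad; apply: eq_bigr => k _; rewrite mxE.
Qed.

Lemma radial_ext_continuous h s F : S2 s ->
  agree_on_S2 (fun F s => {for s, continuous F}) h s F ->
  {for s, continuous (radial_ext h)}.
Proof.
move=> ss FU; have s0 := S2_neq0 s ss.
have Fh := agree_near _ _ _ _ ss FU.
have [U [_ Us cF FE]] := FU.
have cFN : {for s, continuous (F \o normalize)}.
  apply: continuous_comp; first exact: normalize_continuous.
  by rewrite normalize_S2.
have E : (F \o normalize) s = radial_ext h s := nbhs_singleton Fh.
have : (F \o normalize) x @[x --> s] --> radial_ext h s by rewrite -E.
by apply: cvg_trans; exact: near_eq_cvg Fh.
Qed.

Lemma radial_ext_idem h x : x != 0 -> radial_ext h (normalize x) = radial_ext h x.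
Proof. by move=> x0; rewrite /radial_ext -/(normalize _) normalize_S2 //; exact: S2_normalize. Qed.

End normalization.

(** * Regularity of the logarithm and of its derivatives *)

Section c1.
Context {R : realType}.
Local Notation V := 'rV[R]_3.
Implicit Types (F G : V -> R) (x v s : V) (U : set V).

Lemma derive_basis F x v : differentiable F x ->
  'D_v F x = \sum_(k < 3) v 0 k * 'D_(basis_vec R k) F x.
Proof.
move=> dF; rewrite deriveE // {1}(row_sum_delta v) linear_sum.
by apply: eq_bigr => k _; rewrite linearZ -deriveE.
Qed.

(** The partial derivatives enter through formulas [dF] that compute them on [U];
    continuity is then read off the formulas. *)
Definition C1_on U F := exists dF : 'I_3 -> V -> R,
  (forall x, U x -> differentiable F x) /\
  (forall k x, U x -> 'D_(basis_vec R k) F x = dF k x /\ {for x, continuous (dF k)}).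

Let pick_fderiv F (dF : 'I_3 -> V -> R) U :
  (forall x, U x -> fderiv F x (fun v => \sum_(k < 3) v 0 k * dF k x)) ->
  (forall k x, U x -> {for x, continuous (dF k)}) -> C1_on U F.
Proof.
move=> h c; exists dF; split => [x Ux|k x Ux]; first by have [] := h x Ux.
split; last exact: c.
have [_ ->] := h x Ux; rewrite (bigD1 k) //= big1 ?addr0 => [|l lk].
  by rewrite mxE !eqxx mul1r.
by rewrite mxE eqxx (negbTE lk) mul0r.
Qed.

Lemma C1_onP U F : C1_on U F -> exists dF : 'I_3 -> V -> R,
  (forall x, U x -> fderiv F x (fun v => \sum_(k < 3) v 0 k * dF k x)) /\
  (forall k x, U x -> {for x, continuous (dF k)}).
Proof.
move=> [dF [h1 h2]]; exists dF; split => [x Ux|k x Ux]; last by have [] := h2 k x Ux.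
split => [|v]; first exact: h1.
rewrite derive_basis; last exact: h1.
by apply: eq_bigr => k _; have [-> _] := h2 k x Ux.
Qed.

Lemma C1_on_continuous U F x : C1_on U F -> U x -> {for x, continuous F}.
Proof. by move=> [dF [h _]] Ux; exact: differentiable_continuous (h x Ux). Qed.

Lemma C1_on_sub U U' F : U' `<=` U -> C1_on U F -> C1_on U' F.
Proof.
by move=> UU [dF [h1 h2]]; exists dF; split => *; [apply: h1|apply: h2]; exact: UU.
Qed.

Lemma C1_on_cst U (c : R) : C1_on U (fun=> c).
Proof.
apply: (pick_fderiv _ (fun _ _ => 0)) => [x _|k x _]; last exact: cst_continuous.
apply: fderiv_eq (fderiv_cst c x) _ => v.
by rewrite big1 // => k _; rewrite mulr0.
Qed.

Lemma C1_on_coord U k : C1_on U (fun x => x 0 k).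
Proof.
apply: (pick_fderiv _ (fun l _ => (l == k)%:R)) => [x _|l x _]; last exact: cst_continuous.
apply: fderiv_eq (fderiv_coord k x) _ => v.
rewrite (bigD1 k) //= eqxx mulr1 big1 ?addr0 // => l lk.
by rewrite (negbTE lk) mulr0.
Qed.

Lemma C1_onD U F G : C1_on U F -> C1_on U G -> C1_on U (fun x => F x + G x).
Proof.
move=> /C1_onP[dF [F1 F2]] /C1_onP[dG [G1 G2]].
apply: (pick_fderiv _ (fun k x => dF k x + dG k x)) => [x Ux|k x Ux]; last first.
  exact: (continuousD (F2 k x Ux) (G2 k x Ux)).
apply: fderiv_eq (fderivD (F1 x Ux) (G1 x Ux)) _ => v /=.
by rewrite -big_split; apply: eq_bigr => k _; rewrite /= mulrDr.
Qed.

Lemma C1_onM U F G : C1_on U F -> C1_on U G -> C1_on U (fun x => F x * G x).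
Proof.
move=> CF CG; have /C1_onP[dF [F1 F2]] := CF; have /C1_onP[dG [G1 G2]] := CG.
apply: (pick_fderiv _ (fun k x => dF k x * G x + F x * dG k x)) => [x Ux|k x Ux].
  apply: fderiv_eq (fderivM (F1 x Ux) (G1 x Ux)) _ => v /=.
  rewrite mulr_suml mulr_sumr -big_split; apply: eq_bigr => k _ /=; ring.
exact: (continuousD (continuousM (F2 k x Ux) (C1_on_continuous U G x CG Ux))
  (continuousM (C1_on_continuous U F x CF Ux) (G2 k x Ux))).
Qed.

Lemma C1_onN U F : C1_on U F -> C1_on U (fun x => - F x).
Proof.
move=> CF; rewrite (_ : (fun x => - F x) = fun x => -1 * F x).
  exact: C1_onM (C1_on_cst U (-1)) CF.
by apply/funext => x; rewrite mulN1r.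
Qed.

Lemma C1_onV U F : (forall x, U x -> F x != 0) -> C1_on U F ->
  C1_on U (fun x => (F x)^-1).
Proof.
move=> F0 CF; have /C1_onP[dF [F1 F2]] := CF.
apply: (pick_fderiv _ (fun k x => - (F x * F x)^-1 * dF k x)) => [x Ux|k x Ux].
  have dV : is_derive (F x) 1 (@GRing.inv R) (- (F x) ^- 2 *: 1).
    exact: (is_deriveV (F0 x Ux) (is_derive_id (F x) 1)).
  apply: fderiv_eq (@fderiv_comp _ _ _ F x _ dV (F1 x Ux)) _ => v /=.
  rewrite mulr_sumr; apply: eq_bigr => k _.
  by rewrite /GRing.scale /= mulr1 -expr2 mulrCA.
have FFc := C1_on_continuous U F x CF Ux.
have n0 : F x * F x != 0 by rewrite mulf_neq0 ?F0.
have cV : {for x, continuous (fun y => - (F y * F y)^-1)}.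
  by apply: continuousN; apply: (@continuousV _ _ (F \* F)) => //; exact: continuousM.
exact: (continuousM cV (F2 k x Ux)).
Qed.

Lemma C1_on_sum U n (F : 'I_n -> V -> R) : (forall i, C1_on U (F i)) ->
  C1_on U (fun x => \sum_(i < n) F i x).
Proof.
move=> h; elim: n F h => [|n IH] F h.
  under eq_fun do rewrite big_ord0; exact: C1_on_cst.
under eq_fun do rewrite big_ord_recr /=.
by apply: C1_onD => //; apply: IH.
Qed.

Lemma I3_ind (P : 'I_3 -> Prop) : P (inord 0) -> P (inord 1) -> P (inord 2) ->
  forall i, P i.
Proof.
move=> p0 p1 p2 -[[|[|[|//]]] hk].
- by rewrite (_ : Ordinal hk = inord 0) //; apply/val_inj; rewrite /= inordK.
- by rewrite (_ : Ordinal hk = inord 1) //; apply/val_inj; rewrite /= inordK.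
- by rewrite (_ : Ordinal hk = inord 2) //; apply/val_inj; rewrite /= inordK.
Qed.

Lemma b0E x : b (inord 0) x = vec3 0 (- x 0 (inord 2)) (x 0 (inord 1)).
Proof. by rewrite /b inordK. Qed.
Lemma b1E x : b (inord 1) x = vec3 (x 0 (inord 2)) 0 (- x 0 (inord 0)).
Proof. by rewrite /b inordK. Qed.
Lemma b2E x : b (inord 2) x = vec3 (- x 0 (inord 1)) (x 0 (inord 0)) 0.
Proof. by rewrite /b inordK. Qed.
Definition bE := (b0E, b1E, b2E).

Lemma C1_on_b U i l : C1_on U (fun x => b i x 0 l).
Proof.
have cx k := C1_on_coord U k; have c0 := C1_on_cst U 0.
have cN k := C1_onN _ _ (cx k).
by elim/I3_ind: i; elim/I3_ind: l; under eq_fun do rewrite bE vec3_coord.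
Qed.

End c1.

Section smoothness.
Context {R : realType}.
Local Notation V := 'rV[R]_3.
Variables (f : V -> R).
Hypothesis f_gt0 : forall s, S2 s -> 0 < f s.
Hypothesis f_C2 : C2_sphere f.

Let u x := ln (f x).
Let isdiff (F : V -> R) s := differentiable F s.
Let iscont (F : V -> R) s := {for s, continuous F}.

(** If [F] extends [f] near [s], then [ln F] extends [ln f], the derivatives of
    [ln F] along the fields [b j] extend those of [ln f] and are C^1, and the
    derivatives of these are continuous.  The neighbourhood is shrunk to where
    [F > 0]. *)
Lemma C2_sphere_log s : S2 s -> exists (F G : V -> R) (H : 'I_3 -> V -> R)
    (K : 'I_3 -> 'I_3 -> V -> R),
  [/\ agree_on_S2 iscont f s F, agree_on_S2 isdiff u s G,
      forall j, agree_on_S2 isdiff (bgrad j u) s (H j) &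
      forall i j, agree_on_S2 iscont (bgrad i (bgrad j u)) s (K i j)].
Proof.
move=> ss; have [U0 [F [oU0 U0s [F1 F2 F3] Ff]]] := f_C2 s ss.
have CF : C1_on U0 F.
  exists (fun k => 'D_(basis_vec R k) F); split => // k x Ux; split => //.
  exact: differentiable_continuous (F2 k x Ux).
have CF' l : C1_on U0 ('D_(basis_vec R l) F).
  exists (fun k => 'D_(basis_vec R k) ('D_(basis_vec R l) F)).
  by split => [x Ux|k x Ux]; [exact: F2|split => //; exact: F3].
pose U := U0 `&` [set x | 0 < F x].
have oU : open U.
  rewrite openE => x [U0x Fx]; apply: filterI; first exact: open_nbhs_nbhs.
  have cF : {for x, continuous F} := C1_on_continuous _ _ _ CF U0x.
  exact: (cvgr_gt (F x) cF).
have UU0 : U `<=` U0 by move=> x [].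
have Us : U s by split => //=; rewrite Ff //; exact: f_gt0.
have FfU x : U x -> S2 x -> F x = f x by move=> /UU0; exact: Ff.
have CFU := C1_on_sub _ _ _ UU0 CF.
have F0 x : U x -> F x != 0 by move=> [_ /=] Fx; rewrite gt_eqF.
pose G x := ln (F x).
have dG x : U x -> fderiv G x (fun v => (F x)^-1 * 'D_v F x).
  move=> Ux; have [_ Fx] := Ux; have dF := F1 x (UU0 x Ux).
  exact: (fderiv_comp (@ln R) _ (is_derive1_ln Fx) (fderivE _ _ dF)).
have aG x : U x -> agree_on_S2 isdiff u x G.
  move=> Ux; exists U; split => //; first by have [] := dG x Ux.
  by move=> y Uy sy; rewrite /G FfU.
pose H j x := \sum_(l < 3) b j x 0 l * ('D_(basis_vec R l) F x * (F x)^-1).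
have HE j x : U x -> S2 x -> H j x = bgrad j u x.
  move=> Ux sx; rewrite (bgradE j u x G sx (aG x Ux)).
  have [_ ->] := dG x Ux.
  rewrite derive_basis ?mulr_sumr; last exact: F1 (UU0 x Ux).
  by apply: eq_bigr => l _; rewrite mulrA mulrC.
have CH j : C1_on U (H j).
  apply: C1_on_sum => l; apply: C1_onM; first exact: C1_on_b.
  apply: C1_onM; first exact: C1_on_sub UU0 (CF' l).
  exact: C1_onV.
have aH j x : U x -> agree_on_S2 isdiff (bgrad j u) x (H j).
  move=> Ux; exists U; split => //; last exact: HE.
  by have [dH [h _]] := CH j; exact: h.
have [dH hH] := choice CH.
pose K i j x := \sum_(k < 3) b i x 0 k * dH j k x.
exists F, G, H, K; split => //.
- by exists U; split => //; exact: C1_on_continuous CFU Us.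
- exact: aG.
- by move=> j; exact: aH.
- move=> i j; have [h1 h2] := hH j; exists U; split => //.
  + have cb k : {for s, continuous (fun x => b i x 0 k)}.
      exact: C1_on_continuous (C1_on_b setT i k) _.
    have cK k : {for s, continuous (fun x => b i x 0 k * dH j k x)}.
      by apply: continuousM; [exact: cb|have [] := h2 k s Us].
    pose c k x := b i x 0 k * dH j k x.
    have -> : K i j = c (inord 0) \+ c (inord 1) \+ c (inord 2).
      apply/funext => x; rewrite /K !big_ord_recr big_ord0 /= add0r /c.
      by congr (b i x 0 _ * dH j _ x + b i x 0 _ * dH j _ x + b i x 0 _ * dH j _ x);
        apply/val_inj; rewrite /= inordK.
    exact: (continuousD (continuousD (cK _) (cK _)) (cK _)).
  + move=> x Ux sx; rewrite (bgradE i _ x (H j) sx (aH j x Ux)) derive_basis; last exact: h1.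
    by apply: eq_bigr => k _; have [-> _] := h2 k x Ux.
Qed.
End smoothness.

(** * Derivatives along great circles *)

Lemma is_derive_affine (R : realType) (a c t : R) :
  is_derive t 1 (fun t => a + c * t) c.
Proof.
have dc := is_derive_ptZ c (is_derive_id t 1).
apply: (is_derive_pt_eq (is_derive_ptD (is_derive_ptC a t) dc)).
by rewrite mulr1 add0r.
Qed.

Section along_curves.
Context {R : realType}.
Local Notation V := 'rV[R]_3.

Lemma sum3 (W : nmodType) (F : 'I_3 -> W) :
  \sum_(i < 3) F i = F (inord 0) + F (inord 1) + F (inord 2).
Proof.
rewrite !big_ord_recr big_ord0 /= add0r.
by congr (F _ + F _ + F _); apply/val_inj; rewrite /= inordK.
Qed.

(** The fields [b j] generate rotations, so they compute derivatives along
    curves drawn on the sphere. *)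
Lemma is_derive_along (h : V -> R) (F : V -> R) (g : R -> V) (g' : V) (c : 'I_3 -> R) (t : R) :
  (forall t, S2 (g t)) -> agree_on_S2 (fun F s => differentiable F s) h (g t) F ->
  is_derive t 1 g g' -> g' = \sum_(j < 3) c j *: b j (g t) ->
  is_derive t 1 (fun t => h (g t)) (\sum_(j < 3) c j * bgrad j h (g t)).
Proof.
move=> gS FU dg g'E.
have [U [oU Ut dF Fh]] := FU.
have -> : \sum_(j < 3) c j * bgrad j h (g t) = 'D_g' F (g t).
  rewrite deriveE // g'E linear_sum; apply: eq_bigr => j _.
  by rewrite linearZ /= -deriveE // -(bgradE j h (g t) F (gS t) FU).
apply: (near_eq_is_derive _ (fderiv_curve _ _ _ (fderivE _ _ dF) dg)).
have cg : {for t, continuous g}.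
  by case: dg => /derivable1_diffP/differentiable_continuous.
have : \forall s \near t, U (g s) by apply: cg; exact: open_nbhs_nbhs.
by apply: filterS => s Us; exact: Fh.
Qed.

Lemma dot_bgrad (h : V -> R) (x : V) : \sum_(j < 3) x 0 j * bgrad j h x = 0.
Proof. by rewrite sum3 /bgrad !dotE !bE !vec3_coord; ring. Qed.

(** Differentiate the identity [dot_bgrad] along [b i], on the curve obtained by
    projecting the line [s + t b_i(s)] to the sphere. *)
Lemma bgrad_bgrad_radial (h : V -> R) (H : 'I_3 -> V -> R) (i : 'I_3) (s : V) : S2 s ->
  (forall j, agree_on_S2 (fun F s => differentiable F s) (bgrad j h) s (H j)) ->
  \sum_(j < 3) s 0 j * bgrad i (bgrad j h) s =
  - \sum_(j < 3) b i s 0 j * bgrad j h s.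
Proof.
move=> ss Hh.
pose line (t : R) := s + t *: b i s.
have line0 t : line t != 0.
  apply: contraTneq (ltr01 (R := R)) => l0.
  have : dot s (line t) = dot s s + t * dot s (b i s) by rewrite !dotE !mxE; ring.
  rewrite l0 dot_b mulr0 addr0 (S2E s).1 // => <-.
  by rewrite dotE !mxE !mulr0 !addr0 ltxx.
pose g t := normalize (line t).
have gS t : S2 (g t) by exact: S2_normalize.
have lE : line 0 = s by rewrite /line scale0r addr0.
have gE : g 0 = s by rewrite /g lE normalize_S2.
have dl : is_derive (0 : R) (1 : R) line (b i s).
  have dk k : is_derive (0 : R) (1 : R) (fun t : R => s 0 k + b i s 0 k * t) (b i s 0 k).
    exact: is_derive_affine.
  have lv : line = fun t => vec3 (s 0 (inord 0) + b i s 0 (inord 0) * t)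
      (s 0 (inord 1) + b i s 0 (inord 1) * t) (s 0 (inord 2) + b i s 0 (inord 2) * t).
    by apply/funext => t; apply: row3P; rewrite vec3_coord !mxE mulrC.
  have := vec3_is_derive _ _ _ _ _ _ _ (dk (inord 0)) (dk (inord 1)) (dk (inord 2)).
  by rewrite -lv -vec3_eta.
have dg : is_derive (0 : R) (1 : R) g (b i s).
  have dl1 : differentiable line 0 by apply/derivable1_diffP; case: dl.
  have dN : differentiable normalize (line 0) by exact: normalize_differentiable.
  have dg : differentiable (normalize \o line) 0 by exact: differentiable_comp.
  apply: DeriveDef; first exact: diff_derivable.
  rewrite deriveE // diff_comp //= -(deriveE (1 : R) dl1).
  by case: dl => _ ->; rewrite -(deriveE _ dN) lE normalize_derive ?dot_b.
have d j : is_derive (0 : R) (1 : R) (fun t => g t 0 j * bgrad j h (g t))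
    (b i s 0 j * bgrad j h s + s 0 j * bgrad i (bgrad j h) s).
  have d1 : is_derive (0 : R) (1 : R) (fun t => g t 0 j) (b i s 0 j).
    exact: fderiv_curve g (b i s) 0 (fderiv_coord j (g 0)) dg.
  have aH : agree_on_S2 (fun F s => differentiable F s) (bgrad j h) (g 0) (H j) by rewrite gE.
  have E : b i s = \sum_(k < 3) (k == i)%:R *: b k (g 0).
    rewrite gE (bigD1 i) //= eqxx scale1r big1 ?addr0 // => k /negbTE ->.
    by rewrite scale0r.
  have := is_derive_along _ _ _ _ _ _ gS aH dg E.
  rewrite (bigD1 i) //= eqxx mul1r big1 ?addr0 => [|k /negbTE -> ]; last by rewrite mul0r.
  move=> d2; apply: (is_derive_pt_eq (is_derive_ptM d1 d2)).
  by rewrite gE.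
have dz : is_derive (0 : R) (1 : R) (fun _ : R => 0 : R) 0 := is_derive_ptC 0 0.
have ds := is_derive_ptD (is_derive_ptD (d (inord 0)) (d (inord 1))) (d (inord 2)).
have gz : (fun t => g t 0 (inord 0) * bgrad (inord 0) h (g t) +
    g t 0 (inord 1) * bgrad (inord 1) h (g t) +
    g t 0 (inord 2) * bgrad (inord 2) h (g t)) = fun _ => 0.
  by apply/funext => t; rewrite -(sum3 _ (fun j => g t 0 j * bgrad j h (g t))) dot_bgrad.
rewrite gz in ds.
have := is_derive_unique ds dz.
have key (a0 a1 a2 c0 c1 c2 : R) :
    a0 + c0 + (a1 + c1) + (a2 + c2) = 0 -> c0 + c1 + c2 = - (a0 + a1 + a2) by lra.
by rewrite !sum3; exact: key.
Qed.

End along_curves.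

(** * Averages over the unit vectors orthogonal to a point *)

Section inner_integrals.
Context {R : realType}.
Local Notation mu := (@lebesgue_measure R).
Implicit Types (th ph al A C k : R) (w e : 'rV[R]_3).

(** The means of [cos^2], [cos sin] and [sin^2] over ]0, pi[ are 1/2, 0 and 1/2. *)
Lemma trig_quadratic_integral (P Q S k : R) :
  (\int[mu]_(al in `]0%R, pi[) ((P * cos al ^+ 2 + Q * (cos al * sin al) +
     S * sin al ^+ 2) * k)%:E = (pi / 2 * (P + S) * k)%:E)%E.
Proof.
pose f al := (P * cos al ^+ 2 + Q * (cos al * sin al) + S * sin al ^+ 2) * k.
pose F al := k * (P * (2^-1 * (al + sin al * cos al)) +
  S * (2^-1 * (al + - (1) * (sin al * cos al))) + Q * (2^-1 * (sin al * sin al))).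
have cf : continuous f.
  move=> al.
  have cc (c : R) : {for al, continuous (fun _ : R => c)} by exact: cst_continuous.
  have c0 : {for al, continuous (@cos R)} := @continuous_cos R al.
  have s0 : {for al, continuous (@sin R)} := @continuous_sin R al.
  have p1 := continuousM (cc P) (continuousM c0 c0).
  have p2 := continuousM (cc Q) (continuousM c0 s0).
  have p3 := continuousM (cc S) (continuousM s0 s0).
  exact: (continuousM (continuousD (continuousD p1 p2) p3) (cc k)).
have dF al : is_derive al (1 : R) F (f al).
  have ds := is_derive_sin al; have dc := is_derive_cos al.
  have sc := is_derive_ptM ds dc.
  have d1 := is_derive_ptZ P (is_derive_ptZ 2^-1 (is_derive_ptD (is_derive_id al 1) sc)).
  have d2 := is_derive_ptZ S (is_derive_ptZ 2^-1
    (is_derive_ptD (is_derive_id al 1) (is_derive_ptZ (- (1)) sc))).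
  have d3 := is_derive_ptZ Q (is_derive_ptZ 2^-1 (is_derive_ptM ds ds)).
  apply: (is_derive_pt_eq (is_derive_ptZ k (is_derive_ptD (is_derive_ptD d1 d2) d3))).
  apply/eqP; rewrite -subr_eq0 /f.
  rewrite [X in X == 0](_ : _ = k / 2 * (P + S) *
    (1 - (cos al ^+ 2 + sin al ^+ 2))); last by field.
  by rewrite cos2Dsin2 subrr mulr0.
rewrite -(@integral_itv_bndoo _ _ _ _ true false); last first.
  by apply/measurable_EFinP/measurable_funTS; exact: continuous_measurable_fun.
rewrite (FTC2 F f 0 pi (pi_ge0 R) (fun t _ => dF t) (continuous_subspaceT cf)).
by rewrite /F sinpi sin0 !mul0r !mulr0 !addr0; congr (_%:E); field.
Qed.

Definition meridian_dir th ph : 'rV[R]_3 :=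
  vec3 (cos th * cos ph) (cos th * sin ph) (- sin th).
Definition parallel_dir ph : 'rV[R]_3 := vec3 (- sin ph) (cos ph) 0.

Lemma dot_conormal w sg th ph al : dot w (conormal sg th ph al) =
  - (cos al * dot w (meridian_dir th ph)) + sin al * (sg * dot w (parallel_dir ph)).
Proof. by rewrite !dotE !vec3_coord; ring. Qed.

(** The two directions and [spherical (th, ph)] form an orthonormal basis; the
    identity is checked by two plane rotations, by [ph] and then by [th]. *)
Lemma frame_parseval w th ph :
  dot w (meridian_dir th ph) ^+ 2 + dot w (parallel_dir ph) ^+ 2 =
  dot w w - dot w (spherical (th, ph)) ^+ 2.
Proof.
rewrite sphericalE !dotE !vec3_coord.
set w1 := w _ _; set w2 := w _ _; set w3 := w _ _.
pose y1 := cos ph * w1 + sin ph * w2; pose y2 := - sin ph * w1 + cos ph * w2.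
have rot (c s p q : R) : c ^+ 2 + s ^+ 2 = 1 ->
    (c * p - s * q) ^+ 2 + (s * p + c * q) ^+ 2 = p ^+ 2 + q ^+ 2.
  move=> cs; rewrite -[RHS]mul1r -cs; ring.
have y12 : y1 ^+ 2 + y2 ^+ 2 = w1 ^+ 2 + w2 ^+ 2.
  by rewrite [RHS]addrC -(rot _ _ w2 w1 (cos2Dsin2 ph)) /y1 /y2; ring.
have E := rot _ _ y1 w3 (cos2Dsin2 th).
have -> : w1 * w1 + w2 * w2 + w3 * w3 = y1 ^+ 2 + w3 ^+ 2 + y2 ^+ 2.
  by rewrite [RHS]addrAC y12; ring.
by rewrite -E /y1 /y2; ring.
Qed.

Lemma cauchy_schwarz3 e w : dot e w ^+ 2 <= dot e e * dot w w.
Proof.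
rewrite -subr_ge0 !dotE.
set e1 := e _ _; set e2 := e _ _; set e3 := e _ _.
set w1 := w _ _; set w2 := w _ _; set w3 := w _ _.
rewrite [X in 0 <= X](_ : _ = (e1 * w2 - e2 * w1) ^+ 2 + (e1 * w3 - e3 * w1) ^+ 2 +
  (e2 * w3 - e3 * w2) ^+ 2); last by ring.
by rewrite !addr_ge0 ?sqr_ge0.
Qed.

Lemma dot_spherical th ph : dot (spherical (th, ph)) (spherical (th, ph)) = 1 :> R.
Proof.
rewrite sphericalE dotE !vec3_coord.
rewrite [LHS](_ : _ = sin th ^+ 2 * (cos ph ^+ 2 + sin ph ^+ 2) + cos th ^+ 2);
  last by ring.
by rewrite cos2Dsin2 mulr1 addrC cos2Dsin2.
Qed.

Lemma dot_conormal_self sg th ph al : sg ^+ 2 = 1 ->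
  dot (conormal sg th ph al) (conormal sg th ph al) = 1.
Proof.
move=> sg2; rewrite dotE !vec3_coord.
rewrite [LHS](_ : _ = cos al ^+ 2 * (cos th ^+ 2 * (cos ph ^+ 2 + sin ph ^+ 2) +
  sin th ^+ 2) + sg ^+ 2 * sin al ^+ 2 * (cos ph ^+ 2 + sin ph ^+ 2));
  last by ring.
by rewrite cos2Dsin2 sg2 mul1r !mulr1 cos2Dsin2 mulr1 cos2Dsin2.
Qed.

Lemma S2_spherical th ph : S2 (spherical (th, ph) : 'rV[R]_3).
Proof. by apply/S2E; exact: dot_spherical. Qed.

Lemma S2_conormal sg th ph al : sg ^+ 2 = 1 -> S2 (conormal sg th ph al).
Proof. by move=> sg2; apply/S2E; exact: dot_conormal_self. Qed.

(** The sum is the cross product of the velocity of rotation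
    [- sg * spherical (th, ph)] with the moving point: the curve is the great
    circle with axis [spherical (th, ph)], run through at unit speed. *)
Lemma conormal_is_derive sg th ph (al : R) : sg ^+ 2 = 1 ->
  is_derive al 1 (conormal sg th ph)
    (\sum_(j < 3) (- (sg * spherical (th, ph) 0 j)) *: b j (conormal sg th ph al)).
Proof.
move=> sg2.
have dz (c d : R) : is_derive al 1 (fun al => c * cos al + d * sin al)
    (- (c * sin al) + d * cos al).
  apply: (is_derive_pt_eq (is_derive_ptD (is_derive_ptZ c (is_derive_cos al))
    (is_derive_ptZ d (is_derive_sin al)))).
  by rewrite mulrN.
have -> : conormal sg th ph = fun al =>
    vec3 (- (cos th * cos ph) * cos al + - (sg * sin ph) * sin al)
         (- (cos th * sin ph) * cos al + (sg * cos ph) * sin al)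
         (sin th * cos al + 0 * sin al).
  by apply/funext => t; rewrite /conormal; congr vec3; ring.
have := vec3_is_derive _ _ _ _ _ _ _
  (dz (- (cos th * cos ph)) (- (sg * sin ph)))
  (dz (- (cos th * sin ph)) (sg * cos ph)) (dz (sin th) 0).
set L := vec3 _ _ _; set L' := \sum_(j < 3) _; suff -> : L = L' by [].
rewrite /L /L' sum3 sphericalE !vec3_coord !bE.
have thE := cos2Dsin2 th; have phE := cos2Dsin2 ph.
apply: row3P; apply/eqP; rewrite -subr_eq0 !mxE !inordK //=.
- rewrite [X in X == 0](_ : _ = cos th * cos ph * sin al * (1 - sg ^+ 2) -
    sg * sin ph * cos al * (1 - (cos th ^+ 2 + sin th ^+ 2))); last by ring.
  by rewrite thE sg2 !subrr !mulr0 subrr.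
- rewrite [X in X == 0](_ : _ = cos th * sin ph * sin al * (1 - sg ^+ 2) +
    sg * cos ph * cos al * (1 - (cos th ^+ 2 + sin th ^+ 2))); last by ring.
  by rewrite thE sg2 !subrr !mulr0 addr0.
- rewrite [X in X == 0](_ : _ = - (sin th * sin al) * (1 - sg ^+ 2) -
    sin th * sin al * sg ^+ 2 * (1 - (cos ph ^+ 2 + sin ph ^+ 2))); last by ring.
  by rewrite phE sg2 !subrr !mulr0 subrr.
Qed.

Lemma conormal_pi sg th ph al : conormal sg th ph (al + pi) = - conormal sg th ph al.
Proof.
rewrite /conormal cosDpi sinDpi; apply: row3P; rewrite !mxE !inordK //=; ring.
Qed.

End inner_integrals.

(** * The integral over the sphere *)

Section monotonicity.
Import HBNNSimple.

(** The simple functions below [f] are below [g], so the suprema that define the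
    integrals compare for arbitrary nonnegative functions, iterated integrals
    included. *)
Lemma le_integral_ge0 (d : measure_display) (T : measurableType d) (R : realType)
    (m : {measure set T -> \bar R}) (D : set T) (f g : T -> \bar R) :
  (forall x, D x -> (0 <= f x)%E) -> (forall x, D x -> (f x <= g x)%E) ->
  (\int[m]_(x in D) f x <= \int[m]_(x in D) g x)%E.
Proof.
move=> f0 fg.
have g0 x : D x -> (0 <= g x)%E by move=> Dx; exact: le_trans (f0 x Dx) (fg x Dx).
rewrite !ge0_integralE //; apply: ereal_sup_le => /= _ [h hf <-].
exists h => // x.
apply: le_trans (hf x) _; rewrite /patch; case: ifPn => // /set_mem; exact: fg.
Qed.

End monotonicity.

Section sphere_integral.
Context {R : realType}.
Local Notation mu := (@lebesgue_measure R).
Local Notation V := 'rV[R]_3.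
Local Notation rect := (`[0, pi] `*` `[0, 2 * pi] : set (R * R)).

(** Continuity on the sphere, stated for the extension that is constant on rays:
    it is then continuous at every point but the origin. *)
Definition sphere_continuous (h : V -> R) :=
  forall x, x != 0 -> {for x, continuous (radial_ext h)}.

Lemma sphere_continuousP (h : V -> R) :
  (forall s, S2 s -> {for s, continuous (radial_ext h)}) -> sphere_continuous h.
Proof.
move=> ch x x0.
have cn : {for x, continuous (radial_ext h \o normalize)}.
  apply: continuous_comp; first exact: normalize_continuous.
  by apply: ch; exact: S2_normalize.
have E : (radial_ext h \o normalize) x = radial_ext h x by rewrite /= radial_ext_idem.
have Fh : {near x, radial_ext h \o normalize =1 radial_ext h}.
  by apply: filterS (near_neq0 x x0) => y y0; exact: radial_ext_idem.
have : (radial_ext h \o normalize) y @[y --> x] --> radial_ext h x by rewrite -E.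
by apply: cvg_trans; exact: near_eq_cvg Fh.
Qed.

Lemma radial_ext_S2 (h : V -> R) s : S2 s -> radial_ext h s = h s.
Proof. by move=> ss; rewrite /radial_ext -/(normalize _) normalize_S2. Qed.

Lemma sphere_continuousD (h k : V -> R) : sphere_continuous h ->
  sphere_continuous k -> sphere_continuous (fun s => h s + k s).
Proof. by move=> ch ck x x0; exact: (continuousD (ch x x0) (ck x x0)). Qed.

Lemma sphere_continuousM (h k : V -> R) : sphere_continuous h ->
  sphere_continuous k -> sphere_continuous (fun s => h s * k s).
Proof. by move=> ch ck x x0; exact: (continuousM (ch x x0) (ck x x0)). Qed.

Lemma sphere_continuous_cst (c : R) : sphere_continuous (fun=> c).
Proof. by move=> x _; exact: cst_continuous. Qed.

Lemma sphere_continuous_sum n (h : 'I_n -> V -> R) :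
  (forall i, sphere_continuous (h i)) -> sphere_continuous (fun s => \sum_(i < n) h i s).
Proof.
elim: n h => [|n IH] h ch.
  by under eq_fun do rewrite big_ord0; exact: sphere_continuous_cst.
under eq_fun do rewrite big_ord_recr /=.
by apply: sphere_continuousD => //; apply: IH.
Qed.

Let integrand (h : V -> R) (p : R * R) := h (spherical p) * sin p.1.

Let integrandE h : integrand h = fun p => radial_ext h (spherical p) * sin p.1.
Proof.
apply/funext => -[th ph]; rewrite /integrand radial_ext_S2 //.
exact: S2_spherical.
Qed.

Let spherical_continuous : continuous (@spherical R).
Proof.
move=> p.
have c1 : {for p, continuous (fun p : R * R => p.1)} by exact: cvg_fst.
have c2 : {for p, continuous (fun p : R * R => p.2)} by exact: cvg_snd.
have s1 := continuous_comp c1 (@continuous_sin R p.1).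
have s2 := continuous_comp c2 (@continuous_sin R p.2).
have k1 := continuous_comp c1 (@continuous_cos R p.1).
have k2 := continuous_comp c2 (@continuous_cos R p.2).
apply: vec3_cvg; [exact: (continuousM s1 k2)|exact: (continuousM s1 s2)|exact: k1].
Qed.

Lemma integrand_continuous h : sphere_continuous h -> continuous (integrand h).
Proof.
move=> ch p; rewrite integrandE.
have c1 : {for p, continuous (fun p : R * R => p.1)} by exact: cvg_fst.
have s1 := continuous_comp c1 (@continuous_sin R p.1).
have n0 : spherical p != 0 by case: p c1 s1 => th ph _ _; exact: spherical_neq0.
have ck := @continuous_comp _ _ _ (@spherical R) (radial_ext h) p (spherical_continuous p) (ch _ n0).
exact: (continuousM ck s1).
Qed.

Lemma measurable_integrand h : sphere_continuous h -> measurable_fun setT (integrand h).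
Proof.
move=> ch.
have n0 th ph : spherical (th, ph) != 0 :> V by exact: spherical_neq0.
pose k th ph := radial_ext h (spherical (th, ph)) * sin th.
have -> : integrand h = fun p => k p.1 p.2 by rewrite integrandE; apply/funext => -[].
apply: (measurable_caratheodory _ _ _ k) => [ph th|th].
  have cs := @continuous_comp _ _ _ (fun th => spherical (th, ph)) (radial_ext h) th
    (continuous_spherical_th ph th) (ch _ (n0 th ph)).
  exact: (continuousM cs (@continuous_sin R th)).
apply: continuous_measurable_fun => ph.
have cs := @continuous_comp _ _ _ (fun ph => spherical (th, ph)) (radial_ext h) ph
  (continuous_spherical_ph th ph) (ch _ (n0 th ph)).
by apply: (continuousM cs); exact: cst_continuous.
Qed.

Let mI : measurable (`[0, pi]%classic : set R). Proof. exact: measurable_itv. Qed.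
Let mJ : measurable (`[0, 2 * pi]%classic : set R). Proof. exact: measurable_itv. Qed.
Let mrect : measurable rect. Proof. exact: measurableX. Qed.

Lemma sphere_integrable h : sphere_continuous h ->
  (mu \x mu)%E.-integrable rect (EFin \o integrand h).
Proof.
move=> ch.
have frect : ((mu \x mu)%E rect < +oo)%E.
  rewrite (product_measure1E mu mu mI mJ).
  have f1 : (mu `[0%R, pi]%classic < +oo)%E by exact/compact_finite_measure/segment_compact.
  have f2 : (mu `[0%R, (2 * pi)%R]%classic < +oo)%E.
    exact/compact_finite_measure/segment_compact.
  by apply: lte_mul_pinfty => //; rewrite ge0_fin_numE.
apply: measurable_bounded_integrable => //.
  by apply: measurable_funTS; exact: measurable_integrand.
have cr : compact rect by apply: compact_setX; exact: segment_compact.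
have /compact_bounded[M [_ Mb]] := continuous_compact
  (continuous_subspaceT (integrand_continuous h ch)) cr.
exists M; split; rewrite ?num_real // => N MN p pr; apply: (Mb N MN).
by exists p.
Qed.

Lemma sphere_intD (h k : V -> R) : sphere_continuous h -> sphere_continuous k ->
  sphere_int (fun s => h s + k s) = sphere_int h + sphere_int k.
Proof.
move=> ch ck; rewrite /sphere_int.
under eq_Rintegral do rewrite mulrDl.
apply: (RintegralD _ (sphere_integrable h ch) (sphere_integrable k ck)).
exact: mrect.
Qed.

Lemma sphere_intZ (c : R) (h : V -> R) : sphere_continuous h ->
  sphere_int (fun s => c * h s) = c * sphere_int h.
Proof.
move=> ch; rewrite /sphere_int.
under eq_Rintegral do rewrite -mulrA.
apply: (RintegralZl _ _ (sphere_integrable h ch)).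
exact: mrect.
Qed.

Lemma sphere_int_sum n (h : 'I_n -> V -> R) : (forall i, sphere_continuous (h i)) ->
  sphere_int (fun s => \sum_(i < n) h i s) = \sum_(i < n) sphere_int (h i).
Proof.
elim: n h => [|n IH] h ch.
  rewrite big_ord0 (_ : (fun s => _) = fun s => 0 * (0 : R)).
    by rewrite (sphere_intZ 0 _ (sphere_continuous_cst 0)) mul0r.
  by apply/funext => s; rewrite big_ord0 mul0r.
rewrite big_ord_recr /= -IH // -sphere_intD //; last exact: sphere_continuous_sum.
by congr sphere_int; apply/funext => s; rewrite big_ord_recr.
Qed.

Lemma sphere_intE (h : V -> R) : sphere_continuous h ->
  (forall s, S2 s -> 0 <= h s) ->
  ((sphere_int h)%:E = \int[mu]_(th in `]0%R, pi[) \int[mu]_(ph in `[0%R, (2 * pi)%R])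
     (h (spherical (th, ph)) * sin th)%:E)%E.
Proof.
move=> ch h0; rewrite /sphere_int /Rintegral fineK; last first.
  apply: (integrable_fin_num _ (sphere_integrable h ch)).
  exact: mrect.
have mf := measurable_integrand h ch.
have f0 (p : R * R) : `[0, pi]%classic p.1 -> `[0, 2 * pi]%classic p.2 ->
    (0 <= (integrand h p)%:E)%E.
  move=> /=; rewrite in_itv /= => /sin_ge0_pi s0 _; rewrite lee_fin mulr_ge0 //.
  by apply: h0; case: p {s0} => th ph; exact: S2_spherical.
rewrite (tonelli_rect1 _ _ _ _ _ mu mu _ _ (EFin \o integrand h) mI mJ f0); last first.
  by apply/measurable_EFinP/measurable_funTS.
rewrite (@integral_itv_bndoo _ _ _ _ true false) //.
apply: measurable_funS (measurable_tonelli_rect _ _ _ _ _ mu _ _ (EFin \o integrand h)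
  mI mJ f0 _) => //.
- exact: subset_itv_oo_cc.
- by apply/measurable_EFinP/measurable_funTS.
Qed.

End sphere_integral.

(** * Integration over all great circles *)

Section main_inequality.
Context {R : realType}.
Local Notation mu := (@lebesgue_measure R).
Local Notation V := 'rV[R]_3.
Variable f : V -> R.
Hypothesis f_gt0 : forall s, S2 s -> 0 < f s.
Hypothesis f_C2 : C2_sphere f.
Hypothesis f_even : forall s, S2 s -> f s = f (- s).

Let u x := ln (f x).
Let D j := bgrad j u.
Let DD i j := bgrad i (bgrad j u).

Let agree_u s : S2 s -> exists G, agree_on_S2 (fun F s => differentiable F s) u s G.
Proof. by move=> /(C2_sphere_log f f_gt0 f_C2)[F [G [H [K [_ h _ _]]]]]; exists G. Qed.

Let agree_D s : S2 s -> exists H : 'I_3 -> V -> R,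
  forall j, agree_on_S2 (fun F s => differentiable F s) (D j) s (H j).
Proof. by move=> /(C2_sphere_log f f_gt0 f_C2)[F [G [H [K [_ _ h _]]]]]; exists H. Qed.

Let sc_f : sphere_continuous f.
Proof.
apply: sphere_continuousP => s ss.
have [F [G [H [K [h _ _ _]]]]] := C2_sphere_log f f_gt0 f_C2 s ss.
exact: radial_ext_continuous ss h.
Qed.

Let sc_D j : sphere_continuous (D j).
Proof.
apply: sphere_continuousP => s ss; have [H h] := agree_D s ss.
have [U [oU Us dH HE]] := h j.
apply: (radial_ext_continuous _ _ (H j) ss); exists U; split => //.
exact: differentiable_continuous.
Qed.

Let sc_DD i j : sphere_continuous (DD i j).
Proof.
apply: sphere_continuousP => s ss.
have [F [G [H [K [_ _ _ h]]]]] := C2_sphere_log f f_gt0 f_C2 s ss.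
exact: radial_ext_continuous ss (h i j).
Qed.

(* [e^T (DD x) e] and [e . D x], extended off the sphere; the absolute values in
   [K1] and [K2] make these nonnegative at the origin too, where
   [radial_ext f] takes the value of [f] at [0]. *)
Let Qf (x e : V) : R := \sum_(j < 3) e 0 j * \sum_(i < 3) e 0 i * radial_ext (DD i j) x.
Let Lf (x e : V) : R := \sum_(j < 3) e 0 j * radial_ext (D j) x.
Let K1 (x e : V) : R := `|radial_ext f x| * Qf x e ^+ 2.
Let K2 (x e : V) : R := 15 / 4 * (`|radial_ext f x| * Lf x e ^+ 2).

Let K1_ge0 x e : 0 <= K1 x e.
Proof. by rewrite mulr_ge0 ?sqr_ge0. Qed.

Let K2_ge0 x e : 0 <= K2 x e.
Proof. by rewrite mulr_ge0 // mulr_ge0 ?sqr_ge0. Qed.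

Section pair_continuity.
Variables (x e : V).
Hypothesis x0 : x != 0.

Let c1 (h : V -> R) : sphere_continuous h ->
  {for (x, e), continuous (fun p : V * V => radial_ext h p.1)}.
Proof.
move=> ch; have cf : {for (x, e), continuous (fun p : V * V => p.1)} by exact: cvg_fst.
exact: (continuous_comp cf (ch x x0)).
Qed.

Let c2 k : {for (x, e), continuous (fun p : V * V => p.2 0 k)}.
Proof.
have cs : {for (x, e), continuous (fun p : V * V => p.2)} by exact: cvg_snd.
exact: (continuous_comp cs (@coord_continuous R 1 3 0 k e)).
Qed.

Let c_sum (h : 'I_3 -> V * V -> R) : (forall k, {for (x, e), continuous (h k)}) ->
  {for (x, e), continuous (fun p : V * V => \sum_(k < 3) p.2 0 k * h k p)}.
Proof.
move=> ch; have ct k := continuousM (c2 k) (ch k).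
rewrite (_ : (fun p => _) = fun p : V * V => p.2 0 (inord 0) * h (inord 0) p +
  p.2 0 (inord 1) * h (inord 1) p + p.2 0 (inord 2) * h (inord 2) p).
  exact: (continuousD (continuousD (ct _) (ct _)) (ct _)).
by apply/funext => p; rewrite sum3.
Qed.

Let c_norm : {for (x, e), continuous (fun p : V * V => `|radial_ext f p.1|)}.
Proof. exact: (continuous_comp (c1 f sc_f) (@norm_continuous _ R _)). Qed.

Lemma K1_continuous : {for (x, e), continuous (fun p : V * V => K1 p.1 p.2)}.
Proof.
have cQ : {for (x, e), continuous (fun p : V * V => Qf p.1 p.2)}.
  apply: (c_sum (fun j (p : V * V) => \sum_(i < 3) p.2 0 i * radial_ext (DD i j) p.1)) => j.
  apply: (c_sum (fun i (p : V * V) => radial_ext (DD i j) p.1)) => i.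
  exact: c1.
exact: (continuousM c_norm (continuousM cQ cQ)).
Qed.

Lemma K2_continuous : {for (x, e), continuous (fun p : V * V => K2 p.1 p.2)}.
Proof.
have cL : {for (x, e), continuous (fun p : V * V => Lf p.1 p.2)}.
  by apply: (c_sum (fun j (p : V * V) => radial_ext (D j) p.1)) => j; exact: c1.
have cc : {for (x, e), continuous (fun _ : V * V => 15 / 4 : R)} by exact: cst_continuous.
exact: (continuousM cc (continuousM c_norm (continuousM cL cL))).
Qed.
End pair_continuity.

Let K1_sc : sphere2_continuous K1.
Proof. by move=> x e x0 _; exact: K1_continuous. Qed.
Let K2_sc : sphere2_continuous K2.
Proof. by move=> x e x0 _; exact: K2_continuous. Qed.

(** Along the curve [conormal sg be om], the function [ln f] has derivatives
    [- sg * Lf] and [sg^2 * Qf = Qf].  It has period [pi] because [conormal] changes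
    sign there and [f] is even, so [half_circle_wirtinger] applies. *)
Lemma half_great_circle (sg be om : R) : sg ^+ 2 = 1 -> 0 < be < pi ->
  (\int[mu]_(t in `]0%R, pi[)
     (K2 (conormal sg be om t) (spherical (be, om)) * sin be)%:E <=
   \int[mu]_(t in `]0%R, pi[)
     (K1 (conormal sg be om t) (spherical (be, om)) * sin be)%:E)%E.
Proof.
move=> sg2 /sin_gt0_pi/ltW sb0.
pose g := conormal sg be om; pose e : V := spherical (be, om).
have gS t : S2 (g t) by exact: S2_conormal.
have g0 t : g t != 0 by exact: S2_neq0.
pose c j := - (sg * e 0 j).
pose v t := u (g t).
pose v1 t := \sum_(j < 3) c j * D j (g t).
pose v2 t := \sum_(j < 3) c j * \sum_(i < 3) c i * DD i j (g t).
have dg t := conormal_is_derive sg be om t sg2.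
have dv (t : R) : is_derive t 1 v (v1 t).
  have [G aG] := agree_u (g t) (gS t).
  exact: (is_derive_along u G g _ c t gS aG (dg t) erefl).
have dD j (t : R) : is_derive t 1 (fun t => D j (g t)) (\sum_(i < 3) c i * DD i j (g t)).
  have [H aH] := agree_D (g t) (gS t).
  exact: (is_derive_along (D j) (H j) g _ c t gS (aH j) (dg t) erefl).
have dv1 (t : R) : is_derive t 1 v1 (v2 t).
  have d j := is_derive_ptZ (c j) (dD j t).
  have ds := is_derive_ptD (is_derive_ptD (d (inord 0)) (d (inord 1))) (d (inord 2)).
  have -> : v1 = fun t => c (inord 0) * D (inord 0) (g t) +
      c (inord 1) * D (inord 1) (g t) + c (inord 2) * D (inord 2) (g t).
    by apply/funext => s; rewrite /v1 sum3.
  apply: (is_derive_pt_eq ds).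
  by rewrite /v2 (sum3 _ (fun j => c j * \sum_(i < 3) c i * DD i j (g t))).
have cg : continuous g := continuous_conormal_al sg be om.
have cr (h : V -> R) : sphere_continuous h -> continuous (fun t => h (g t)).
  move=> ch t; rewrite (_ : (fun t => h (g t)) = radial_ext h \o g).
    exact: (continuous_comp (cg t) (ch _ (g0 t))).
  by apply/funext => s; rewrite /= radial_ext_S2.
have ccs (h : 'I_3 -> R -> R) : (forall j, continuous (h j)) ->
    continuous (fun t => \sum_(j < 3) c j * h j t).
  move=> ch t.
  have cc j : {for t, continuous (fun t => c j * h j t)}.
    by apply: (@continuousM _ _ (fun=> c j)); [exact: cst_continuous|exact: ch].
  rewrite (_ : (fun t => _) = fun t => c (inord 0) * h (inord 0) t +
    c (inord 1) * h (inord 1) t + c (inord 2) * h (inord 2) t).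
    exact: (continuousD (continuousD (cc _) (cc _)) (cc _)).
  by apply/funext => s; rewrite sum3.
have cv1 : continuous v1 by apply: ccs => j; exact: cr.
have cv2 : continuous v2.
  have inner j := ccs (fun i t => DD i j (g t)) (fun i => cr _ (sc_DD i j)).
  exact: (ccs _ inner).
have vpi t : v (t + pi) = v t.
  by rewrite /v /g conormal_pi /u -f_even.
have expv t : expR (v t) = f (g t) by rewrite lnK // posrE f_gt0.
have W := half_circle_wirtinger v v1 v2 dv dv1 cv2 vpi.
have csum (h : 'I_3 -> R) : \sum_(j < 3) c j * h j = - sg * \sum_(j < 3) e 0 j * h j.
  by rewrite mulr_sumr; apply: eq_bigr => j _; rewrite /c; ring.
have v1E t : v1 t = - sg * Lf (g t) e.
  by rewrite /v1 csum /Lf; under [in RHS]eq_bigr do rewrite radial_ext_S2 //.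
have v2E t : v2 t = Qf (g t) e.
  pose S j := \sum_(i < 3) e 0 i * DD i j (g t).
  have QE : Qf (g t) e = \sum_(j < 3) e 0 j * S j.
    rewrite /Qf.
    apply: eq_bigr => j _.
    rewrite /S.
    apply: (congr1 ( *%R (e 0 j))).
    apply: eq_bigr => i _.
    apply: (congr1 ( *%R (e 0 i))).
    exact: (radial_ext_S2 (DD i j) (g t) (gS t)).
  have vE : v2 t = \sum_(j < 3) c j * (- sg * S j).
    by apply: eq_bigr => j _; congr (_ * _); exact: (csum (fun i => DD i j (g t))).
  have vE' : v2 t = - sg * \sum_(j < 3) e 0 j * (- sg * S j).
    by rewrite vE; exact: (csum (fun j => - sg * S j)).
  have key (p q : R) : - sg * (p * (- sg * q)) = p * q.
    rewrite [LHS](_ : _ = sg ^+ 2 * (p * q)); last by ring.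
    by rewrite sg2 mul1r.
  rewrite vE' QE mulr_sumr; apply: eq_bigr => j _.
  exact: key.
have fE t : `|radial_ext f (g t)| = expR (v t).
  rewrite (radial_ext_S2 f (g t) (gS t)) expv ger0_norm //.
  exact: (ltW (f_gt0 _ (gS t))).
have K1E t : K1 (g t) e = expR (v t) * v2 t ^+ 2.
  by rewrite /K1 (fE t) (v2E t).
have K2E t : K2 (g t) e = 15 / 4 * (expR (v t) * v1 t ^+ 2).
  by rewrite /K2 (fE t) (v1E t) exprMn sqrrN sg2 mul1r.
have cexp : continuous (fun t => expR (v t)).
  by under eq_fun do rewrite expv; exact: cr.
have cE (c0 : R) (w : R -> R) : continuous w ->
    continuous (fun t => c0 * (expR (v t) * w t ^+ 2)).
  move=> cw t; have cc : {for t, continuous (fun _ : R => c0)} by exact: cst_continuous.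
  exact: (continuousM cc (continuousM (cexp t) (continuousM (cw t) (cw t)))).
have scale (c0 : R) (w : R -> R) : 0 <= c0 -> continuous w ->
    (\int[mu]_(t in `]0%R, pi[) (c0 * (expR (v t) * w t ^+ 2) * sin be)%:E =
     (sin be)%:E * \int[mu]_(t in `[0%R, pi]) (c0 * (expR (v t) * w t ^+ 2))%:E)%E.
  move=> c00 cw; rewrite (@integral_itv_bndoo _ _ _ _ true false); last first.
    apply/measurable_EFinP/measurable_funTS.
    by apply: continuous_measurable_fun; exact: cE.
  rewrite -ge0_integralZl_EFin //.
  - by apply: eq_integral => t _; rewrite -EFinM mulrC.
  - by move=> t _; rewrite lee_fin mulr_ge0 // mulr_ge0 ?expR_ge0 ?sqr_ge0.
  - apply/measurable_EFinP/measurable_funTS.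
    by apply: continuous_measurable_fun; exact: cE.
have L2 : (\int[mu]_(t in `]0%R, pi[) (K2 (g t) e * sin be)%:E =
    (sin be)%:E * \int[mu]_(t in `[0%R, pi]) (15 / 4 * (expR (v t) * v1 t ^+ 2))%:E)%E.
  have c0 : 0 <= 15 / 4 :> R by rewrite divr_ge0.
  have E := scale (15 / 4) v1 c0 cv1.
  apply: etrans E.
  apply: eq_integral => t _.
  apply: (congr1 (fun r : R => (r * sin be)%:E)).
  exact: K2E.
have L1 : (\int[mu]_(t in `]0%R, pi[) (K1 (g t) e * sin be)%:E =
    (sin be)%:E * \int[mu]_(t in `[0%R, pi]) (expR (v t) * v2 t ^+ 2)%:E)%E.
  have E := scale 1 v2 ler01 cv2.
  apply: etrans (etrans E _).
    apply: eq_integral => t _.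
    apply: (congr1 (fun r : R => (r * sin be)%:E)).
    by apply: etrans (K1E t) _; rewrite mul1r.
  apply: (congr1 (fun r => (sin be)%:E * r)%E).
  by apply: eq_integral => t _; rewrite mul1r.
rewrite [leLHS]L2 [leRHS]L1; apply: lee_pmul => //.
by apply: integral_ge0 => t _; rewrite lee_fin mulr_ge0 // mulr_ge0 ?expR_ge0 ?sqr_ge0.
Qed.


Let energy x := \sum_(i < 3) f x * D i x ^+ 2.
Let energy2 x := \sum_(i < 3) \sum_(j < 3) f x * DD i j x ^+ 2.

Let square_expand (k c s : R) (a b : 'I_3 -> R) :
  k * \sum_(i < 3) (- (c * a i) + s * b i) ^+ 2 =
  k * (\sum_(i < 3) a i ^+ 2) * c ^+ 2 +
  - (2) * k * (\sum_(i < 3) a i * b i) * (c * s) + k * (\sum_(i < 3) b i ^+ 2) * s ^+ 2.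
Proof. by rewrite !sum3; ring. Qed.

Let rD x : V := \row_j D j x.
Let rDD i x : V := \row_j DD i j x.

Let dot_rD x : S2 x -> dot (rD x) x = 0.
Proof.
move=> _; rewrite -[RHS](dot_bgrad u x) /dot; apply: eq_bigr => j _.
by rewrite mxE mulrC.
Qed.

(** By [bgrad_bgrad_radial] the left side is the squared length of the cross
    product of [rD x] with [x], and these two are orthogonal. *)
Let sum_dot_rDD x : S2 x -> \sum_(i < 3) dot (rDD i x) x ^+ 2 = \sum_(i < 3) D i x ^+ 2.
Proof.
move=> sx; have [H aH] := agree_D x sx.
have E i : dot (rDD i x) x = - dot (b i x) (rD x).
  have := bgrad_bgrad_radial u H i x sx aH; rewrite /dot => E.
  rewrite (_ : \sum_(k < 3) b i x 0 k * rD x 0 k =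
    \sum_(j < 3) b i x 0 j * bgrad j u x); last by apply: eq_bigr => k _; rewrite mxE.
  by rewrite -E; apply: eq_bigr => k _; rewrite mxE mulrC.
have L : \sum_(i < 3) dot (rDD i x) x ^+ 2 =
    dot (rD x) (rD x) * dot x x - dot (rD x) x ^+ 2.
  rewrite sum3 !E; move: (rD x) => w; rewrite !bE !dotE !vec3_coord; ring.
rewrite L dot_rD // (S2E x).1 // mulr1 expr0n subr0 /dot.
by apply: eq_bigr => i _; rewrite !mxE.
Qed.

Let dot_rDD i x : dot (rDD i x) (rDD i x) = \sum_(j < 3) DD i j x ^+ 2.
Proof. by apply: eq_bigr => j _; rewrite !mxE. Qed.

Let dot_rDE x : dot (rD x) (rD x) = \sum_(j < 3) D j x ^+ 2.
Proof. by apply: eq_bigr => j _; rewrite !mxE. Qed.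

Let normf x : S2 x -> `|radial_ext f x| = f x.
Proof.
by move=> sx; rewrite (radial_ext_S2 f x sx) ger0_norm //; exact: (ltW (f_gt0 x sx)).
Qed.

Let LfE x e : S2 x -> Lf x e = dot (rD x) e.
Proof.
move=> sx; rewrite /dot /Lf; apply: eq_bigr => j _.
by rewrite (radial_ext_S2 (D j) x sx) mxE mulrC.
Qed.

(** Cauchy-Schwarz for [e] and the vector with entries [dot (rDD i x) e]. *)
Let Qf_le x e : S2 x -> dot e e = 1 -> Qf x e ^+ 2 <= \sum_(i < 3) dot (rDD i x) e ^+ 2.
Proof.
move=> sx e1; pose w : V := \row_i dot (rDD i x) e.
have -> : Qf x e = dot e w.
  rewrite /Qf /dot.
  transitivity (\sum_(j < 3) \sum_(i < 3) e 0 j * (e 0 i * DD i j x)).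
    apply: eq_bigr => j _; rewrite mulr_sumr; apply: eq_bigr => i _.
    by rewrite (radial_ext_S2 (DD i j) x sx).
  rewrite exchange_big; apply: eq_bigr => i _; rewrite mxE /dot mulr_sumr.
  by apply: eq_bigr => j _; rewrite mxE; ring.
have -> : \sum_(i < 3) dot (rDD i x) e ^+ 2 = dot w w.
  by rewrite [RHS]/dot; apply: eq_bigr => i _; rewrite !mxE.
by apply: le_trans (cauchy_schwarz3 e w) _; rewrite e1 mul1r.
Qed.

Lemma inner_K2 (th ph : R) :
  (\int[mu]_(al in `]0%R, pi[)
     (K2 (spherical (th, ph)) (conormal 1 th ph al) * sin th)%:E =
   (pi / 2 * (15 / 4) * energy (spherical (th, ph)) * sin th)%:E)%E.
Proof.
set x := spherical (th, ph); have sx : S2 x by exact: S2_spherical.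
pose A := dot (rD x) (meridian_dir th ph); pose C := dot (rD x) (parallel_dir ph).
have AC : A ^+ 2 + C ^+ 2 = \sum_(j < 3) D j x ^+ 2.
  by rewrite frame_parseval -/x dot_rD // expr0n subr0 dot_rDE.
have E := trig_quadratic_integral (15 / 4 * f x * A ^+ 2) (- (2) * (15 / 4 * f x) * (A * C))
  (15 / 4 * f x * C ^+ 2) (sin th).
have -> : pi / 2 * (15 / 4) * energy x * sin th =
    pi / 2 * (15 / 4 * f x * A ^+ 2 + 15 / 4 * f x * C ^+ 2) * sin th.
  rewrite -mulrDr AC /energy -mulr_sumr; ring.
apply: etrans E; apply: eq_integral => al _.
apply: (congr1 (fun r : R => (r * sin th)%:E)).
rewrite /K2 (normf x sx) (LfE x _ sx) dot_conormal mul1r -/A -/C.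
by clear AC; move: A C => a c; ring.
Qed.

(** [Qf_le] bounds the integrand by the quadratic form [|X e|^2], whose mean over
    the [e] orthogonal to [x] is [1/2 (|X|^2 - |X x|^2)], and [sum_dot_rDD]
    evaluates [|X x|^2]. *)
Lemma inner_K1 (th ph : R) : 0 < th < pi ->
  (\int[mu]_(al in `]0%R, pi[)
     (K1 (spherical (th, ph)) (conormal 1 th ph al) * sin th)%:E <=
   (pi / 2 * (energy2 (spherical (th, ph)) + - (1) * energy (spherical (th, ph))) *
     sin th)%:E)%E.
Proof.
move=> thI; have sth := ltW (sin_gt0_pi thI).
set x := spherical (th, ph); have sx : S2 x by exact: S2_spherical.
pose A i := dot (rDD i x) (meridian_dir th ph); pose C i := dot (rDD i x) (parallel_dir ph).
have AC : \sum_(i < 3) A i ^+ 2 + \sum_(i < 3) C i ^+ 2 =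
    \sum_(i < 3) \sum_(j < 3) DD i j x ^+ 2 - \sum_(i < 3) D i x ^+ 2.
  rewrite -(sum_dot_rDD x sx) -sumrB -big_split; apply: eq_bigr => i _ /=.
  by rewrite -dot_rDD; exact: frame_parseval.
have E := trig_quadratic_integral (f x * \sum_(i < 3) A i ^+ 2)
  (- (2) * f x * \sum_(i < 3) A i * C i) (f x * \sum_(i < 3) C i ^+ 2) (sin th).
have -> : pi / 2 * (energy2 x + - (1) * energy x) * sin th =
    pi / 2 * (f x * (\sum_(i < 3) A i ^+ 2) + f x * \sum_(i < 3) C i ^+ 2) * sin th.
  rewrite -mulrDr AC /energy2 /energy.
  have -> : \sum_(i < 3) \sum_(j < 3) f x * DD i j x ^+ 2 =
      f x * \sum_(i < 3) \sum_(j < 3) DD i j x ^+ 2.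
    by rewrite mulr_sumr; apply: eq_bigr => i _; rewrite mulr_sumr.
  by rewrite -mulr_sumr; ring.
rewrite -E; apply: le_integral_ge0 => al _.
  by rewrite lee_fin mulr_ge0 // K1_ge0.
rewrite lee_fin; apply: ler_wpM2r => //.
rewrite /K1 (normf x sx).
apply: le_trans (ler_wpM2l (ltW (f_gt0 x sx)) (Qf_le x _ sx _)) _.
  by apply: dot_conormal_self; rewrite expr1n.
rewrite -(square_expand (f x) (cos al) (sin al) A C).
rewrite le_eqVlt; apply/orP; left; apply/eqP; congr (_ * _).
by apply: eq_bigr => i _; rewrite dot_conormal mul1r.
Qed.

(** [inner_K2], [flag_int_swap] for [K2], [half_great_circle], [flag_int_swap] for
    [K1] and [inner_K1], chained in this order. *)
Lemma sphere_energy_inequality :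
  pi / 2 * (15 / 4) * sphere_int energy <=
  pi / 2 * (sphere_int energy2 + - (1) * sphere_int energy).
Proof.
have sc_e : sphere_continuous energy.
  apply: sphere_continuous_sum => i; apply: sphere_continuousM => //.
  exact: (sphere_continuousM (D i) (D i)).
have sc_e2 : sphere_continuous energy2.
  apply: sphere_continuous_sum => i; apply: sphere_continuous_sum => j.
  apply: sphere_continuousM => //.
  exact: (sphere_continuousM (DD i j) (DD i j)).
have cst c : sphere_continuous (fun _ : V => c) by exact: sphere_continuous_cst.
have sc_Ne := sphere_continuousM _ _ (cst (- (1))) sc_e.
have sc_d := sphere_continuousD _ _ sc_e2 sc_Ne.
have sc1 := sphere_continuousM _ _ (cst (pi / 2)) sc_d.
have sc2 := sphere_continuousM _ _ (cst (pi / 2 * (15 / 4))) sc_e.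
have p0 : 0 <= pi / 2 :> R by rewrite divr_ge0 // pi_ge0.
have e0 s : S2 s -> 0 <= energy s.
  by move=> ss; apply: sumr_ge0 => i _; rewrite mulr_ge0 ?sqr_ge0 // ltW // f_gt0.
(* [sphere_intE] asks for a nonnegative integrand; here [|X x| <= |X|]. *)
have d0 s : S2 s -> 0 <= energy2 s + - (1) * energy s.
  move=> ss; rewrite mulN1r subr_ge0 /energy -mulr_sumr -(sum_dot_rDD s ss).
  rewrite mulr_sumr; apply: ler_sum => i _; rewrite -mulr_sumr.
  apply: ler_wpM2l; first exact: (ltW (f_gt0 s ss)).
  apply: le_trans (cauchy_schwarz3 _ _) _.
  by rewrite (S2E s).1 // mulr1 dot_rDD.
have E2 := sphere_intE _ sc2 (fun s ss => mulr_ge0 (mulr_ge0 p0 _) (e0 s ss)).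
have E1 := sphere_intE _ sc1 (fun s ss => mulr_ge0 p0 (d0 s ss)).
rewrite -sphere_intZ // -sphere_intZ // -[X in _ <= _ * X]sphere_intD // -sphere_intZ //.
rewrite -lee_fin E1 {}E2; last by rewrite divr_ge0.
have one2 : (1 : R) ^+ 2 = 1 by rewrite expr1n.
have S1 := flag_int_swap 1 K1 one2 K1_ge0 K1_sc.
have S2 := flag_int_swap 1 K2 one2 K2_ge0 K2_sc.
have -> : (\int[mu]_(th in `]0%R, pi[) \int[mu]_(ph in `[0%R, (2 * pi)%R])
    (pi / 2 * (15 / 4) * energy (spherical (th, ph)) * sin th)%:E = flag_int 1 K2)%E.
  apply: eq_integral => th _; apply: eq_integral => ph _; apply/esym; exact: inner_K2.
rewrite S2.
apply: (@le_trans _ _ (flag_int 1 K1)).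
  rewrite S1; apply: le_integral_ge0 => be; rewrite /= in_itv /= => beI.
    apply: integral_ge0 => om _; apply: integral_ge0 => t _.
    rewrite lee_fin; apply: mulr_ge0; first exact: K2_ge0.
    exact: (ltW (sin_gt0_pi beI)).
  apply: le_integral_ge0 => om _.
    apply: integral_ge0 => t _.
    rewrite lee_fin; apply: mulr_ge0; first exact: K2_ge0.
    exact: (ltW (sin_gt0_pi beI)).
  have sgN : (- (1 : R)) ^+ 2 = 1 by rewrite sqrrN.
  exact: (half_great_circle (- (1)) be om sgN beI).
apply: le_integral_ge0 => th; rewrite /= in_itv /= => thI.
  apply: integral_ge0 => ph _; apply: integral_ge0 => al _.
  rewrite lee_fin; apply: mulr_ge0; first exact: K1_ge0.
  exact: (ltW (sin_gt0_pi thI)).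
apply: le_integral_ge0 => ph _; last exact: inner_K1.
apply: integral_ge0 => al _.
rewrite lee_fin; apply: mulr_ge0; first exact: K1_ge0.
  exact: (ltW (sin_gt0_pi thI)).
Qed.

Lemma sphere_energy_sum :
  19 / 4 * (\sum_(i < 3) sphere_int (fun s => f s * D i s ^+ 2)) <=
  \sum_(i < 3) \sum_(j < 3) sphere_int (fun s => f s * DD i j s ^+ 2).
Proof.
have scD i : sphere_continuous (fun s => f s * D i s ^+ 2).
  by apply: sphere_continuousM => //; exact: (sphere_continuousM (D i) (D i)).
have scDD i j : sphere_continuous (fun s => f s * DD i j s ^+ 2).
  by apply: sphere_continuousM => //; exact: (sphere_continuousM (DD i j) (DD i j)).
have E1 : sphere_int energy = \sum_(i < 3) sphere_int (fun s => f s * D i s ^+ 2).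
  exact: (sphere_int_sum 3 (fun i s => f s * D i s ^+ 2) scD).
have E2 : sphere_int energy2 =
    \sum_(i < 3) \sum_(j < 3) sphere_int (fun s => f s * DD i j s ^+ 2).
  apply: etrans (sphere_int_sum 3 (fun i s => \sum_(j < 3) f s * DD i j s ^+ 2) _) _.
    by move=> i; exact: (sphere_continuous_sum 3 (fun j s => f s * DD i j s ^+ 2) (scDD i)).
  apply: eq_bigr => i _.
  exact: (sphere_int_sum 3 (fun j s => f s * DD i j s ^+ 2) (scDD i)).
have := sphere_energy_inequality; rewrite E1 E2.
move: (\sum_(i < 3) _) (\sum_(i < 3) _) => P Q.
rewrite -mulrA ler_pM2l ?divr_gt0 ?pi_gt0 //; lra.
Qed.

End main_inequality.

Theorem lemma9p1 (R : realType) (f : 'rV[R]_3 -> R)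
  (f_gt0 : forall s, S2 s -> 0 < f s)
  (f_C2 : C2_sphere f)
  (f_even : forall s, S2 s -> f s = f (- s)) :
  \sum_(i < 3) \sum_(j < 3)
     sphere_int (fun s => f s * (bgrad i (bgrad j (fun x => ln (f x))) s) ^+ 2)
  >= 19 / 4 *
     \sum_(i < 3) sphere_int (fun s => f s * (bgrad i (fun x => ln (f x)) s) ^+ 2).
Proof. exact: sphere_energy_sum. Qed.
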